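(* Let $\kappa:\mathbb{D}\to\mathbb{R}$ be a locally Hölder continuous function with $\kappa(0)<0$. If $u:\mathbb{D}^*\to\mathbb{R}$ is a $C^2$-solution to $\Delta u=-\kappa(z)e^{2u}$ in $\mathbb{D}^*$ with order $\alpha=1$ at the point $z=0$, then the remainder function $w$ defined by $u(z)=-\log|z|-\log\log(1/|z|)+w(z)$ satisfies $$w_{z\bar z}(z)=O\left(|z|^{-2}(\log(1/|z|))^{-3}\right)\quad\text{as } z\to0.$$
   Context: $\mathbb{D}=\{z\in\mathbb{C}:|z|<1\}$ and $\mathbb{D}^*=\mathbb{D}\setminus\{0\}$. $\Delta$ is the Laplace operator; $w_{z\bar z}=\frac{\partial^2 w}{\partial z\,\partial\bar z}$ (Wirtinger derivatives). The order of a real-valued function $u$ defined in a punctured neighborhood of $0$ is $\alpha(u)=\lim_{r\to0^+}\frac{\sup_{|z|=r}u(z)}{\log(1/r)}$, if this limit exists. It is known (Kraus–Roth) that every $C^2$-solution $u$ of $\Delta u=-\kappa e^{2u}$ in $\mathbb{D}^*$, with $\kappa$ locally Hölder continuous on $\mathbb{D}$ and $\kappa(0)<0$, has an order $\alpha\in(-\infty,1]$ and that, for $\alpha=1$, the remainder $w(z)=u(z)+\log|z|+\log\log(1/|z|)$ extends continuously to $\mathbb{D}$. *)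

(* Defs.v *)
(* Stdlib reals with Coquelicot; the plane is Coquelicot's C = R * R. *)
From Stdlib Require Import Reals.
From Coquelicot Require Import Coquelicot.

Open Scope R_scope.

Definition disk (z : C) : Prop := Cmod z < 1.
Definition punctured_disk (z : C) : Prop := disk z /\ z <> RtoC 0.

(* The exponent and the constant may depend on the point p.  The case z1 = z2
   is excluded because Rpower 0 a = 1 in Stdlib. *)
Definition locally_holder_on (D : C -> Prop) (f : C -> R) : Prop :=
  forall p : C, D p ->
  exists a M : R, 0 < a <= 1 /\
  exists delta : posreal, forall z1 z2 : C,
    D z1 -> D z2 ->
    Cmod (z1 - p)%C < delta -> Cmod (z2 - p)%C < delta -> z1 <> z2 ->
    Rabs (f z1 - f z2) <= M * Rpower (Cmod (z1 - z2)%C) a.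

(* Derive is total, so these are meaningful only where the partial derivatives
   exist; C1_on and C2_on assert that existence. *)
Definition partial_x (f : C -> R) (z : C) : R :=
  Derive (fun t => f (t, Im z)) (Re z).
Definition partial_y (f : C -> R) (z : C) : R :=
  Derive (fun t => f (Re z, t)) (Im z).

(* Meant for open D: the slices and the continuity look at a full
   neighbourhood of each point of D. *)
Definition C1_on (D : C -> Prop) (f : C -> R) : Prop :=
  forall z : C, D z ->
    ex_derive (fun t => f (t, Im z)) (Re z) /\
    ex_derive (fun t => f (Re z, t)) (Im z) /\
    continuous (partial_x f) z /\
    continuous (partial_y f) z.

Definition C2_on (D : C -> Prop) (f : C -> R) : Prop :=
  C1_on D f /\ C1_on D (partial_x f) /\ C1_on D (partial_y f).

Definition laplacian (f : C -> R) (z : C) : R :=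
  partial_x (partial_x f) z + partial_y (partial_y f) z.

Definition Cpartial_x (f : C -> C) (z : C) : C :=
  (partial_x (fun s => Re (f s)) z, partial_x (fun s => Im (f s)) z).
Definition Cpartial_y (f : C -> C) (z : C) : C :=
  (partial_y (fun s => Re (f s)) z, partial_y (fun s => Im (f s)) z).

Definition wirtinger_z (f : C -> C) (z : C) : C :=
  (/ 2 * (Cpartial_x f z - Ci * Cpartial_y f z))%C.
Definition wirtinger_zbar (f : C -> C) (z : C) : C :=
  (/ 2 * (Cpartial_x f z + Ci * Cpartial_y f z))%C.

Definition wirtinger_z_zbar (f : C -> R) : C -> C :=
  wirtinger_z (wirtinger_zbar (fun z => RtoC (f z))).

(* Lub_Rbar lives in Rbar and is coerced to R (infinite values go to 0); for u
   continuous on the circle the supremum is finite. *)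
Definition circle_sup (u : C -> R) (r : R) : R :=
  real (Lub_Rbar (fun y => exists z : C, Cmod z = r /\ y = u z)).

Definition has_order (u : C -> R) (alpha : R) : Prop :=
  filterlim (fun r => circle_sup u r / ln (1 / r)) (at_right 0) (locally alpha).

Definition bigO_at_0 (f : C -> C) (g : C -> R) : Prop :=
  exists M : R, locally' (RtoC 0) (fun z => Cmod (f z) <= M * Rabs (g z)).

(* Main.v *)
(* In the coordinates z = e^(-s) e^(it) put v = u - s.  Then v is 2 pi-periodic in
   t and v_ss + v_tt = K e^(2v) with K -> k := - kappa(0) > 0 exponentially fast,
   and the order hypothesis says that sup_t v(s,t) = o(s).  Since
   w_(z zbar) = (K e^(2w) - 1) / (4 |z|^2 s^2), everything reduces to
   v = - log s - (log k)/2 + O(1/s).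

   Upper bound: - log (s - b) - (log k)/2 + 1/s is a supersolution, and
   v = o(s) from above makes the maximum principle applicable on the half-cylinder.

   For the lower bound one first needs v >= - o(s) at every point, not only at the
   maximum of each circle.  As v is bounded above and v_ss + v_tt is bounded and
   nonnegative, the mean of v over circles is convex and the Fourier
   coefficients grow at most linearly, so the equations a_n'' = n^2 a_n + O(1) force
   a_n = O(1/n^2) uniformly in s.  Fejer summation then bounds the oscillation of v
   on circles.  The subsolution
   - log (s + b) - (log k)/2 - (b/2)/(s + 2b) finishes the proof. *)
Require Import Defs.
From Stdlib Require Import Reals Lra Lia Psatz.
From Coquelicot Require Import Coquelicot.

Open Scope R_scope.

(** * Maximum principle on a strip *)


(** The maximum principle is the only tool taken from elliptic theory. The half-cylinder is not
    compact, so a comparison needs control as s tends to infinity; a term eps s has Laplacian zero,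
    leaves the differential inequality intact and turns growth o(s) into that control. The barriers
    perturb the exact solutions - ln (s + c) - (ln k)/2 of phi'' = k exp(2 phi). The free
    translation c fits the data on one initial circle and alters the value by O(1/s) only, which is
    exactly the accuracy required. The correction terms supply the margin that absorbs K - k, used
    in the weak form |K - k| <= k/s^3. The order hypothesis gives a lower estimate at just one point
    of each circle, and an oscillation bound uniform in s is needed to spread it. Fejer kernels
    recover point values from Fourier coefficients by positivity and continuity alone, so no theorem
    on convergence of Fourier series is required. *)

Lemma max_on_rectangle (f : R -> R -> R) (a b c d eta : R) :
  a <= b -> c <= d -> 0 < eta ->
  (forall x y, a - eta <= x <= b + eta -> c <= y <= d -> continuity_2d_pt f x y) ->
  exists x0 y0, a <= x0 <= b /\ c <= y0 <= d /\
    forall x y, a <= x <= b -> c <= y <= d -> f x y <= f x0 y0.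
Proof.
intros Hab Hcd Heta Hf.
(* [G x] is the maximum over the slice at [x]; uniform continuity makes [G] continuous, so the
   one-variable theorem is applied twice. The margin [eta] gives the endpoints [a] and [b] two-sided
   neighbourhoods. *)
set (G := fun x => real (Lub_Rbar (fun z => exists y, c <= y <= d /\ z = f x y))).
assert (HG : forall x, a - eta <= x <= b + eta ->
   exists y, c <= y <= d /\ G x = f x y /\ forall y', c <= y' <= d -> f x y' <= G x).
{ intros x Hx.
  destruct (continuity_ab_maj (f x) c d Hcd) as [y [Hy1 Hy2]].
  { intros y Hy. apply continuity_pt_locally. intros eps.
    destruct (Hf x y Hx Hy eps) as [delta Hd]. exists delta. intros u Hu.
    apply Hd. rewrite Rminus_eq_0, Rabs_R0; apply cond_pos. exact Hu. }
  assert (HGx : G x = f x y).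
  { unfold G. rewrite (is_lub_Rbar_unique _ (Finite (f x y))); [reflexivity|].
    split.
    - intros z [y' [Hy' ->]]. simpl. now apply Hy1.
    - intros l Hl. apply Hl. now exists y. }
  exists y. rewrite HGx. auto. }
destruct (continuity_ab_maj G a b Hab) as [x0 [Hx0 Hx0']].
{ intros x Hx. apply continuity_pt_locally. intros eps.
  destruct (uniform_continuity_2d f (a - eta) (b + eta) c d Hf eps) as [delta Hd].
  assert (Hm : 0 < Rmin delta eta) by (apply Rmin_pos; [apply cond_pos | lra]).
  exists (mkposreal _ Hm). intros u Hu. change (Rabs (u - x) < Rmin delta eta) in Hu.
  assert (Hu1 : Rabs (u - x) < delta) by (eapply Rlt_le_trans; [apply Hu | apply Rmin_l]).
  assert (Hu2 : Rabs (u - x) < eta) by (eapply Rlt_le_trans; [apply Hu | apply Rmin_r]).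
  apply Rabs_def2 in Hu2.
  destruct (HG x) as [y1 [Hy1 [E1 M1]]]; [lra|].
  destruct (HG u) as [y2 [Hy2 [E2 M2]]]; [lra|].
  assert (P0 : forall y : R, Rabs (y - y) < delta)
    by (intros y; rewrite Rminus_eq_0, Rabs_R0; apply cond_pos).
  assert (D1 := Hd x y1 u y1 ltac:(lra) Hy1 ltac:(lra) Hy1 Hu1 (P0 _)).
  assert (D2 := Hd x y2 u y2 ltac:(lra) Hy2 ltac:(lra) Hy2 Hu1 (P0 _)).
  apply Rabs_def2 in D1. apply Rabs_def2 in D2.
  specialize (M1 y2 Hy2). specialize (M2 y1 Hy1).
  apply Rabs_def1; lra. }
destruct (HG x0) as [y0 [Hy0 [E0 M0]]]; [lra|].
exists x0, y0. split; [assumption|split; [assumption|]].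
intros x y Hx Hy. destruct (HG x) as [_ [_ [_ Mx]]]; [lra|].
rewrite <- E0. apply Rle_trans with (G x); auto.
Qed.

(** Fermat's rule gives [g' x = 0]. If [d] were positive, [g'] would be positive just to the right
    of [x], and the mean value theorem would lift [g] above its maximum. *)
Lemma second_derivative_at_max (g g' : R -> R) (x d delta : R) :
  0 < delta ->
  (forall y, Rabs (y - x) < delta -> is_derive g y (g' y)) ->
  is_derive g' x d ->
  (forall y, Rabs (y - x) < delta -> g y <= g x) -> d <= 0.
Proof.
intros Hdelta Hg Hg' Hmax.
assert (Hx : is_derive g x (g' x)) by (apply Hg; rewrite Rminus_eq_0, Rabs_R0; lra).
assert (H0 : g' x = 0).
{ destruct (Req_dec (g' x) 0) as [E|N]; [exact E|exfalso].
  apply is_derive_Reals in Hx.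
  destruct (Hx (Rabs (g' x) / 2)) as [e He].
  { apply Rabs_pos_lt in N; lra. }
  assert (Hm : 0 < Rmin e delta) by (apply Rmin_pos; [apply cond_pos | lra]).
  set (h0 := Rmin e delta / 2).
  assert (Hh0 : 0 < h0 < e /\ h0 < delta).
  { unfold h0. generalize (Rmin_l e delta) (Rmin_r e delta). lra. }
  assert (A1 : forall h, h <> 0 -> Rabs h = h0 ->
     (g (x + h) - g x) / h * h <= 0 /\ Rabs ((g (x + h) - g x) / h - g' x) < Rabs (g' x) / 2).
  { intros h Hh Hhh. split.
    - replace ((g (x + h) - g x) / h * h) with (g (x + h) - g x) by (field; auto).
      assert (g (x + h) <= g x); [|lra].
      apply Hmax. replace (x + h - x) with h by ring. lra.
    - apply He; auto. lra. }
  destruct (A1 h0) as [B1 B2]; [lra|apply Rabs_pos_eq; lra|].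
  destruct (A1 (- h0)) as [B3 B4]; [lra|rewrite Rabs_Ropp; apply Rabs_pos_eq; lra|].
  destruct (Rle_or_lt 0 (g' x)) as [P|P].
  - rewrite (Rabs_pos_eq (g' x)) in * by lra. apply Rabs_def2 in B2. nra.
  - rewrite (Rabs_left (g' x)) in * by lra. apply Rabs_def2 in B4. nra. }
destruct (Rle_or_lt d 0) as [D|D]; [exact D|exfalso].
apply is_derive_Reals in Hg'.
destruct (Hg' (d / 2)) as [e He]; [lra|].
assert (Hm : 0 < Rmin e delta) by (apply Rmin_pos; [apply cond_pos | lra]).
set (h0 := Rmin e delta / 2).
assert (Hh0 : 0 < h0 < e /\ h0 < delta).
{ unfold h0. generalize (Rmin_l e delta) (Rmin_r e delta). lra. }
destruct (MVT_cor2 g g' x (x + h0)) as [c [Ec Hc]]; [lra| |].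
- intros y Hy. apply is_derive_Reals, Hg. apply Rabs_def1; lra.
- assert (Hle : g (x + h0) <= g x) by (apply Hmax; apply Rabs_def1; lra).
  assert (T := He (c - x) ltac:(lra) ltac:(rewrite Rabs_pos_eq; lra)).
  replace (x + (c - x)) with c in T by ring.
  rewrite H0 in T. apply Rabs_def2 in T.
  assert (0 < g' c); [|nra].
  replace (g' c) with ((g' c - 0) / (c - x) * (c - x)) by (field; lra). nra.
Qed.

Lemma period_reduction (f : R -> R) t :
  (forall t, f (t + 2 * PI) = f t) -> -2 * PI <= t <= 2 * PI ->
  exists t', - PI <= t' <= PI /\ f t' = f t.
Proof.
intros Hper Ht. generalize PI_RGT_0; intros Hpi.
destruct (Rle_or_lt t (- PI)).
- exists (t + 2 * PI). split; [lra|apply Hper].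
- destruct (Rle_or_lt t PI).
  + exists t. split; [lra|reflexivity].
  + exists (t - 2 * PI). split; [lra|]. rewrite <- (Hper (t - 2 * PI)).
    f_equal; ring.
Qed.

(* The closed band |t| <= 2 pi contains two periods, so a maximum over it is
   also attained at an interior point of the band. *)
Lemma strip_maximum_principle (f fs ft fss ftt : R -> R -> R) (s0 s1 s2 : R) :
  s0 < s1 -> s1 <= s2 ->
  (forall s t, s0 < s -> continuity_2d_pt f s t) ->
  (forall s t, s0 < s -> f s (t + 2 * PI) = f s t) ->
  (forall s t, s0 < s -> is_derive (fun x => f x t) s (fs s t)) ->
  (forall s t, s0 < s -> is_derive (fun x => fs x t) s (fss s t)) ->
  (forall s t, s0 < s -> is_derive (fun y => f s y) t (ft s t)) ->
  (forall s t, s0 < s -> is_derive (fun y => ft s y) t (ftt s t)) ->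
  (forall t, -2 * PI <= t <= 2 * PI -> f s1 t <= 0) ->
  (forall t, -2 * PI <= t <= 2 * PI -> f s2 t <= 0) ->
  (forall s t, s1 < s < s2 -> -2 * PI <= t <= 2 * PI -> 0 < f s t ->
     0 < fss s t + ftt s t) ->
  forall s t, s1 <= s <= s2 -> -2 * PI <= t <= 2 * PI -> f s t <= 0.
Proof.
intros H01 H12 Hc Hper Hs Hss Ht Htt B1 B2 Hpos s t Hst Htb.
generalize PI_RGT_0; intros Hpi.
destruct (max_on_rectangle f s1 s2 (-2 * PI) (2 * PI) ((s1 - s0) / 2))
  as [x [y [Hx [Hy Hmax]]]]; try lra.
{ intros; apply Hc; lra. }
destruct (period_reduction (f x) y) as [y' [Hy' E]];
  [intros; apply Hper; lra|exact Hy|].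
apply Rle_trans with (f x y); [now apply Hmax|].
destruct (Rle_or_lt (f x y) 0) as [L|L]; [exact L|exfalso].
rewrite <- E in Hmax, L.
assert (x <> s1) by (intros ->; specialize (B1 y' ltac:(lra)); lra).
assert (x <> s2) by (intros ->; specialize (B2 y' ltac:(lra)); lra).
assert (P := Hpos x y' ltac:(lra) ltac:(lra) L).
assert (Q1 : fss x y' <= 0).
{ apply (second_derivative_at_max (fun x => f x y') (fun x => fs x y') x _
     (Rmin (x - s1) (s2 - x))).
  - apply Rmin_pos; lra.
  - intros z Hz. apply Hs. apply Rabs_def2 in Hz.
    generalize (Rmin_l (x - s1) (s2 - x)). lra.
  - apply Hss. lra.
  - intros z Hz. apply Hmax; [|lra]. apply Rabs_def2 in Hz.
    generalize (Rmin_l (x - s1) (s2 - x)) (Rmin_r (x - s1) (s2 - x)). lra. }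
assert (Q2 : ftt x y' <= 0).
{ apply (second_derivative_at_max (fun z => f x z) (fun z => ft x z) y' _ PI).
  - lra.
  - intros z Hz. apply Ht; lra.
  - apply Htt. lra.
  - intros z Hz. apply Hmax; [lra|]. apply Rabs_def2 in Hz. lra. }
lra.
Qed.

(** * Fejer summation *)


Fixpoint dirichlet_kernel (n : nat) (t : R) : R :=
  match n with
  | O => 1
  | S k => dirichlet_kernel k t + 2 * cos (INR (S k) * t)
  end.

(* [n] times the usual Fejer kernel. *)
Fixpoint fejer_kernel (n : nat) (t : R) : R :=
  match n with
  | O => 0
  | S k => fejer_kernel k t + dirichlet_kernel k t
  end.

(** Division-free substitute for the closed formula of the Dirichlet kernel; the induction step is 2
    cos a cos t = cos (a + t) + cos (a - t). *)
Lemma dirichlet_kernel_telescope n t :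
  dirichlet_kernel n t * (1 - cos t) = cos (INR n * t) - cos (INR (S n) * t).
Proof.
induction n as [|n IH].
- simpl. rewrite Rmult_0_l, cos_0, !Rmult_1_l. ring.
- change (dirichlet_kernel (S n) t) with (dirichlet_kernel n t + 2 * cos (INR (S n) * t)).
  rewrite Rmult_plus_distr_r, IH.
  replace (INR n * t) with (INR (S n) * t - t) by (rewrite S_INR; ring).
  replace (INR (S (S n)) * t) with (INR (S n) * t + t) by (rewrite !S_INR; ring).
  rewrite cos_minus, cos_plus. ring.
Qed.

(** Gives positivity, and also concentration at 0: against 1 - cos t the kernel, of mass 2 pi n,
    stays below 2. *)
Lemma fejer_kernel_telescope n t :
  fejer_kernel n t * (1 - cos t) = 1 - cos (INR n * t).
Proof.
induction n as [|n IH].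
- simpl. rewrite !Rmult_0_l, cos_0. ring.
- change (fejer_kernel (S n) t) with (fejer_kernel n t + dirichlet_kernel n t).
  rewrite Rmult_plus_distr_r, IH, dirichlet_kernel_telescope. ring.
Qed.

(** The telescoped identity decides the sign unless cos t = 1; there every cosine equals 1 and all
    terms are positive. *)
Lemma fejer_kernel_ge0 n t : 0 <= fejer_kernel n t.
Proof.
destruct (Req_dec (cos t) 1) as [E|N].
- assert (Hs : sin t = 0) by (generalize (sin2_cos2 t); rewrite E; unfold Rsqr; nra).
  assert (Hc : forall k, cos (INR k * t) = 1).
  { induction k as [|k IH]; [simpl; rewrite Rmult_0_l; apply cos_0|].
    replace (INR (S k) * t) with (INR k * t + t) by (rewrite S_INR; ring).
    rewrite cos_plus, IH, E, Hs. ring. }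
  assert (Hd : forall k, 0 <= dirichlet_kernel k t).
  { induction k as [|k IH]; [simpl; lra|].
    change (0 <= dirichlet_kernel k t + 2 * cos (INR (S k) * t)). rewrite Hc. lra. }
  induction n as [|n IH]; [simpl; lra|].
  change (0 <= fejer_kernel n t + dirichlet_kernel n t). specialize (Hd n). lra.
- assert (H := fejer_kernel_telescope n t).
  generalize (COS_bound t) (COS_bound (INR n * t)). nra.
Qed.

Lemma continuous_cos_mult a x : continuous (fun t => cos (a * t)) x.
Proof. apply (ex_derive_continuous (V := R_NormedModule)). auto_derive. auto. Qed.

Lemma continuous_dirichlet_kernel n x : continuous (dirichlet_kernel n) x.
Proof.
induction n as [|n IH].
- apply continuous_const.
- apply (continuous_plus (V := R_NormedModule) (dirichlet_kernel n)
    (fun t => 2 * cos (INR (S n) * t))); [exact IH|].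
  apply (ex_derive_continuous (V := R_NormedModule)). auto_derive. auto.
Qed.

Lemma continuous_fejer_kernel n x : continuous (fejer_kernel n) x.
Proof.
induction n as [|n IH].
- apply continuous_const.
- apply (continuous_plus (V := R_NormedModule) (fejer_kernel n) (dirichlet_kernel n));
  [exact IH|apply continuous_dirichlet_kernel].
Qed.

Lemma ex_RInt_cont (f : R -> R) a b : (forall x, continuous f x) -> ex_RInt f a b.
Proof. intros H. apply (ex_RInt_continuous (V := R_CompleteNormedModule)). auto. Qed.

Lemma continuous_Rmult (f g : R -> R) x :
  continuous f x -> continuous g x -> continuous (fun y => f y * g y) x.
Proof. intros; now apply (continuous_mult (K := R_AbsRing) f g). Qed.

Lemma continuous_Rplus (f g : R -> R) x :
  continuous f x -> continuous g x -> continuous (fun y => f y + g y) x.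
Proof. intros; now apply (continuous_plus (V := R_NormedModule) f g). Qed.

Lemma continuous_Rminus (f g : R -> R) x :
  continuous f x -> continuous g x -> continuous (fun y => f y - g y) x.
Proof. intros; now apply (continuous_minus (V := R_NormedModule) f g). Qed.

Lemma RInt_Rplus (f g : R -> R) a b :
  (forall x, continuous f x) -> (forall x, continuous g x) ->
  RInt (fun x => f x + g x) a b = RInt f a b + RInt g a b.
Proof.
intros. apply (RInt_plus (V := R_CompleteNormedModule)); now apply ex_RInt_cont.
Qed.

Lemma RInt_Rminus (f g : R -> R) a b :
  (forall x, continuous f x) -> (forall x, continuous g x) ->
  RInt (fun x => f x - g x) a b = RInt f a b - RInt g a b.
Proof.
intros. apply (RInt_minus (V := R_CompleteNormedModule)); now apply ex_RInt_cont.
Qed.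

Lemma RInt_Rscal (f : R -> R) a b l :
  (forall x, continuous f x) ->
  RInt (fun x => l * f x) a b = l * RInt f a b.
Proof.
intros. apply (RInt_scal (V := R_CompleteNormedModule)); now apply ex_RInt_cont.
Qed.

Lemma RInt_Rconst a b c : RInt (fun _ => c) a b = (b - a) * c.
Proof. apply (RInt_const (V := R_CompleteNormedModule)). Qed.

(** Unnormalised, and without a sine counterpart: the kernels are even and recover the value at
    angle 0 only. Other angles are reached by rotating the function. *)
Definition cos_coef (f : R -> R) (n : nat) : R :=
  RInt (fun t => f t * cos (INR n * t)) (- PI) PI.

Lemma sin_INR_PI n : sin (INR n * PI) = 0.
Proof. apply sin_eq_0_1. exists (Z.of_nat n). now rewrite <- INR_IZR_INZ. Qed.

Lemma cos_coef_const c n : (0 < n)%nat -> cos_coef (fun _ => c) n = 0.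
Proof.
intros Hn. assert (0 < INR n) by (apply lt_0_INR; lia).
unfold cos_coef. apply is_RInt_unique.
replace 0 with (minus (c * (sin (INR n * PI) / INR n)) (c * (sin (INR n * - PI) / INR n))).
- apply (is_RInt_derive (V := R_CompleteNormedModule)
    (fun t => c * (sin (INR n * t) / INR n)) (fun t => c * cos (INR n * t))).
  + intros x _. auto_derive; [auto|]. field; lra.
  + intros x _. apply (ex_derive_continuous (V := R_NormedModule)). auto_derive. auto.
- replace (INR n * - PI) with (- (INR n * PI)) by ring. rewrite sin_neg, sin_INR_PI.
  unfold minus, plus, opp; simpl. field; lra.
Qed.

(** The difference is twice the sum of the coefficients of index 1 to [n], and 1/k^2 <= 2 (1/k -
    1/(k+1)) telescopes. *)
Lemma RInt_mult_dirichlet (f : R -> R) B n :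
  (forall x, continuous f x) -> 0 <= B ->
  (forall k, (0 < k)%nat -> Rabs (cos_coef f k) <= B / INR k ^ 2) ->
  Rabs (RInt (fun t => f t * dirichlet_kernel n t) (- PI) PI - RInt f (- PI) PI)
  <= 4 * B * (1 - / (INR (S n))).
Proof.
intros Hf HB Hk. induction n as [|n IH].
- rewrite (RInt_ext (fun t => f t * dirichlet_kernel 0 t) f)
    by (intros; simpl; ring).
  rewrite Rminus_eq_0, Rabs_R0. simpl. lra.
- rewrite (RInt_ext (fun t => f t * dirichlet_kernel (S n) t)
    (fun t => f t * dirichlet_kernel n t + 2 * (f t * cos (INR (S n) * t))))
    by (intros; change (dirichlet_kernel (S n) x)
          with (dirichlet_kernel n x + 2 * cos (INR (S n) * x)); simpl; ring).
  rewrite RInt_Rplus, RInt_Rscal.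
  + change (RInt (fun t => f t * cos (INR (S n) * t)) (- PI) PI) with (cos_coef f (S n)).
    specialize (Hk (S n) ltac:(lia)).
    match goal with |- Rabs (?a + 2 * ?b - ?c) <= _ =>
      replace (a + 2 * b - c) with ((a - c) + 2 * b) by ring end.
    eapply Rle_trans; [apply Rabs_triang|].
    rewrite (Rabs_mult 2), (Rabs_pos_eq 2) by lra.
    assert (Hp : 0 < INR (S n)) by (apply lt_0_INR; lia).
    rewrite (S_INR (S n)). set (m := INR (S n)) in *.
    assert (Hm : 1 <= m) by (apply (le_INR 1); lia).
    assert (E : 4 * B * (1 - / (m + 1)) - 4 * B * (1 - / m) - 2 * (B / m ^ 2)
       = 2 * B * (m - 1) / (m ^ 2 * (m + 1))) by (field; lra).
    assert (0 <= 2 * B * (m - 1) / (m ^ 2 * (m + 1))).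
    { apply Rdiv_le_0_compat; [nra|]. apply Rmult_lt_0_compat; nra. }
    lra.
  + intros x; apply continuous_Rmult; auto. apply continuous_cos_mult.
  + intros x; apply continuous_Rmult; auto. apply continuous_dirichlet_kernel.
  + intros x. apply continuous_Rmult; [apply continuous_const|].
    apply continuous_Rmult; auto. apply continuous_cos_mult.
Qed.

Lemma RInt_mult_fejer (f : R -> R) B n :
  (forall x, continuous f x) -> 0 <= B ->
  (forall k, (0 < k)%nat -> Rabs (cos_coef f k) <= B / INR k ^ 2) ->
  Rabs (RInt (fun t => f t * fejer_kernel n t) (- PI) PI - INR n * RInt f (- PI) PI)
  <= INR n * (4 * B).
Proof.
intros Hf HB Hk. induction n as [|n IH].
- rewrite (RInt_ext (fun t => f t * fejer_kernel 0 t) (fun _ => 0))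
    by (intros; simpl; ring).
  rewrite RInt_Rconst. simpl. rewrite Rmult_0_r, !Rmult_0_l, Rminus_0_r, Rabs_R0. lra.
- rewrite (RInt_ext (fun t => f t * fejer_kernel (S n) t)
    (fun t => f t * fejer_kernel n t + f t * dirichlet_kernel n t))
    by (intros; simpl; ring).
  rewrite RInt_Rplus.
  + assert (D := RInt_mult_dirichlet f B n Hf HB Hk).
    assert (0 < / INR (S n)) by (apply Rinv_0_lt_compat, lt_0_INR; lia).
    rewrite S_INR.
    match goal with |- Rabs (?a + ?b - (_ + 1) * ?c) <= _ =>
      replace (a + b - (INR n + 1) * c) with ((a - INR n * c) + (b - c)) by ring end.
    eapply Rle_trans; [apply Rabs_triang|]. nra.
  + intros x; apply continuous_Rmult; auto. apply continuous_fejer_kernel.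
  + intros x; apply continuous_Rmult; auto. apply continuous_dirichlet_kernel.
Qed.

(* Korovkin's test function [1 - cos] controls the oscillation at [0]. *)
Lemma oscillation_le_cos (f : R -> R) :
  (forall x, continuous f x) ->
  exists c, 0 <= c /\ forall t, - PI <= t <= PI ->
    Rabs (f t - f 0) <= 1 + c * (1 - cos t).
Proof.
intros Hf. generalize PI_RGT_0; intros Hpi.
assert (Hc : forall x, continuity_pt (fun t => Rabs (f t - f 0)) x).
{ intros x. apply continuity_pt_filterlim.
  apply (continuous_comp (fun t => f t - f 0) Rabs).
  - apply continuous_Rminus; [apply Hf|apply continuous_const].
  - apply continuity_pt_filterlim, Rcontinuity_abs. }
destruct (continuity_ab_maj (fun t => Rabs (f t - f 0)) (- PI) PI) as [m [Hm _]];
  [lra|auto|].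
set (M := Rabs (f m - f 0)) in *.
assert (HM : 0 <= M) by apply Rabs_pos.
assert (H0 : continuity_pt f 0) by (apply continuity_pt_filterlim, Hf).
destruct (proj1 (continuity_pt_locally f 0) H0 (mkposreal 1 Rlt_0_1)) as [d Hd].
set (e := Rmin d PI / 2).
assert (He : 0 < e < d /\ e < PI).
{ unfold e. generalize (Rmin_l d PI) (Rmin_r d PI) (Rmin_pos d PI (cond_pos d) Hpi). lra. }
assert (Hce : 0 < 1 - cos e).
{ assert (cos e < cos 0) by (apply cos_decreasing_1; lra). rewrite cos_0 in *. lra. }
(* Within [e] of 0 continuity bounds the difference by 1. Farther away 1 - cos t >= 1 - cos e, so
   this factor makes the second term reach the global maximum [M]. *)
exists (M / (1 - cos e)). split; [now apply Rdiv_le_0_compat|].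
intros t Ht. generalize (COS_bound t); intros Hcb.
assert (0 <= M / (1 - cos e)) by now apply Rdiv_le_0_compat.
destruct (Rlt_or_le (Rabs t) e) as [L|L].
- assert (Rabs (f t - f 0) < 1); [|nra].
  apply Hd. change (Rabs (t - 0) < d). rewrite Rminus_0_r. lra.
- assert (cos t <= cos e).
  { assert (Habs : cos (Rabs t) = cos t).
    { unfold Rabs; destruct (Rcase_abs t); [apply cos_neg|reflexivity]. }
    rewrite <- Habs. destruct (Req_dec (Rabs t) e) as [->|N]; [lra|].
    apply Rlt_le, cos_decreasing_1; try lra. apply Rabs_le; lra. }
  apply Rle_trans with M; [now apply Hm|].
  assert (M = M / (1 - cos e) * (1 - cos e)) by (field; lra). nra.
Qed.

(** [f - f 0] is tested against a Fejer kernel of mass 2 pi n. The factor [c] of the oscillation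
    bound depends on [f] without any uniformity, but its contribution stays bounded in [n] and
    disappears on division by [n]. What survives depends on [B] alone; 2 pi is the crude 1 of the
    oscillation bound times the length of the circle. *)
Lemma mean_deviation_le (f : R -> R) B :
  (forall x, continuous f x) -> 0 <= B ->
  (forall k, (0 < k)%nat -> Rabs (cos_coef f k) <= B / INR k ^ 2) ->
  Rabs (RInt f (- PI) PI - 2 * PI * f 0) <= 4 * B + 2 * PI.
Proof.
intros Hf HB Hk. generalize PI_RGT_0; intros Hpi.
destruct (oscillation_le_cos f Hf) as [c [Hc Hosc]].
set (D := RInt f (- PI) PI - 2 * PI * f 0).
assert (Key : forall n, INR n * Rabs D <= INR n * (4 * B + 2 * PI) + 4 * PI * c).
{ intros n. assert (HS := continuous_fejer_kernel n).
  assert (I1 : RInt (fejer_kernel n) (- PI) PI = INR n * (2 * PI)).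
  (* The nonconstant coefficients of the constant 1 vanish, so [B = 0] is admissible and the
     estimate becomes an equality. *)
  { assert (T := RInt_mult_fejer (fun _ => 1) 0 n (fun x => continuous_const 1 x)
      (Rle_refl 0)).
    rewrite (RInt_ext (fun t => 1 * fejer_kernel n t) (fejer_kernel n)) in T
      by (intros; apply Rmult_1_l).
    rewrite RInt_Rconst in T.
    assert (T' := T ltac:(intros k Hk0; rewrite cos_coef_const, Rabs_R0 by lia;
      unfold Rdiv; rewrite Rmult_0_l; lra)).
    rewrite Rmult_0_r, Rmult_0_r in T'.
    apply Rabs_le_between in T'. nra. }
  assert (F := RInt_mult_fejer f B n Hf HB Hk).
  assert (I2 : Rabs (RInt (fun t => (f t - f 0) * fejer_kernel n t) (- PI) PI)
      <= INR n * (2 * PI) + 4 * PI * c).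
  { eapply Rle_trans; [apply abs_RInt_le; [lra|]|].
    - apply ex_RInt_cont. intros x. apply continuous_Rmult; auto.
      apply continuous_Rminus; [auto|apply continuous_const].
    - rewrite <- I1.
      (* The kernel times 1 - cos x is 1 - cos (n x) <= 2, so the second term of the oscillation
         bound contributes at most [2 * c] pointwise. *)
      replace (4 * PI * c) with (RInt (fun _ => 2 * c) (- PI) PI)
        by (rewrite RInt_Rconst; simpl; lra).
      rewrite <- RInt_Rplus; [|auto|intros; apply continuous_const].
      apply RInt_le; [lra| | |].
      + apply ex_RInt_cont. intros x.
        apply (continuous_comp (fun t => (f t - f 0) * fejer_kernel n t) Rabs).
        * apply continuous_Rmult; auto.
          apply continuous_Rminus; [auto|apply continuous_const].
        * apply continuity_pt_filterlim, Rcontinuity_abs.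
      + apply ex_RInt_cont. intros x. apply continuous_Rplus; [auto|apply continuous_const].
      + intros x Hx. rewrite Rabs_mult, (Rabs_pos_eq (fejer_kernel n x))
          by apply fejer_kernel_ge0.
        assert (O := Hosc x ltac:(lra)). assert (P := fejer_kernel_ge0 n x).
        assert (T := fejer_kernel_telescope n x).
        assert (V := COS_bound (INR n * x)).
        apply Rle_trans with ((1 + c * (1 - cos x)) * fejer_kernel n x); [nra|].
        replace ((1 + c * (1 - cos x)) * fejer_kernel n x)
          with (fejer_kernel n x + c * (fejer_kernel n x * (1 - cos x))) by ring.
        rewrite T. nra. }
  rewrite (RInt_ext (fun t => (f t - f 0) * fejer_kernel n t)
    (fun t => f t * fejer_kernel n t - f 0 * fejer_kernel n t)) in I2
    by (intros; simpl; ring).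
  rewrite RInt_Rminus, RInt_Rscal, I1 in I2; auto.
  2:{ intros; now apply continuous_Rmult. }
  2:{ intros; apply continuous_Rmult; [apply continuous_const|auto]. }
  assert (Hn := pos_INR n).
  rewrite <- (Rabs_pos_eq (INR n)) at 1 by exact Hn. rewrite <- Rabs_mult. unfold D.
  apply Rabs_le_between in I2. apply Rabs_le_between in F.
  apply Rabs_le. lra. }
apply le_epsilon. intros eps Heps.
destruct (archimed_cor1 (eps / (4 * PI * c + 1))) as [n [Hn Hn0]].
{ apply Rdiv_lt_0_compat; nra. }
specialize (Key n). assert (Hp : 0 < INR n) by now apply lt_0_INR.
assert (4 * PI * c <= INR n * eps).
{ apply Rmult_lt_compat_l with (r := INR n * (4 * PI * c + 1)) in Hn.
  - field_simplify in Hn; [lra|nra|lra].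
  - apply Rmult_lt_0_compat; nra. }
apply Rmult_le_reg_l with (INR n); nra.
Qed.

(** * Functions on the half-cylinder *)


(** Derivatives are explicit functions, so that rotated and polar formulas can be supplied directly.
    Joint continuity serves the existence of maxima and differentiation under the integral;
    periodicity of [vt] cancels the boundary terms in integration by parts. *)
Record cyl_C2 (s0 : R) (v vs vt vss vtt : R -> R -> R) : Prop := {
  cyl_per : forall s t, s0 < s -> v s (t + 2 * PI) = v s t;
  cyl_per_t : forall s t, s0 < s -> vt s (t + 2 * PI) = vt s t;
  cyl_ds : forall s t, s0 < s -> is_derive (fun x => v x t) s (vs s t);
  cyl_dss : forall s t, s0 < s -> is_derive (fun x => vs x t) s (vss s t);
  cyl_dt : forall s t, s0 < s -> is_derive (fun y => v s y) t (vt s t);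
  cyl_dtt : forall s t, s0 < s -> is_derive (fun y => vt s y) t (vtt s t);
  cyl_c : forall s t, s0 < s -> continuity_2d_pt v s t;
  cyl_cs : forall s t, s0 < s -> continuity_2d_pt vs s t;
  cyl_css : forall s t, s0 < s -> continuity_2d_pt vss s t;
  cyl_ctt : forall s t, s0 < s -> continuity_2d_pt vtt s t }.

Lemma continuity_2d_pt_snd (f : R -> R -> R) s t :
  continuity_2d_pt f s t -> continuous (f s) t.
Proof.
intros H. apply continuity_pt_filterlim. apply continuity_pt_locally. intros eps.
destruct (H eps) as [d Hd]. exists d. intros u Hu. apply Hd; [|exact Hu].
rewrite Rminus_eq_0, Rabs_R0; apply cond_pos.
Qed.

Lemma continuity_2d_pt_shift (f : R -> R -> R) s t c :
  continuity_2d_pt f s (t + c) -> continuity_2d_pt (fun x y => f x (y + c)) s t.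
Proof.
intros H eps. destruct (H eps) as [d Hd]. exists d. intros x y Hx Hy.
apply Hd; [exact Hx|]. now replace (y + c - (t + c)) with (y - t) by ring.
Qed.

Lemma is_derive_shift (f : R -> R) t c l :
  is_derive f (t + c) l -> is_derive (fun y => f (y + c)) t l.
Proof.
intros H. replace l with (scal 1 l) by (unfold scal; simpl; unfold mult; simpl; ring).
apply (is_derive_comp f (fun y => y + c)); [exact H|].
auto_derive; [auto|ring].
Qed.

Lemma cyl_C2_rotate s0 v vs vt vss vtt c :
  cyl_C2 s0 v vs vt vss vtt ->
  cyl_C2 s0 (fun s t => v s (t + c)) (fun s t => vs s (t + c)) (fun s t => vt s (t + c))
    (fun s t => vss s (t + c)) (fun s t => vtt s (t + c)).
Proof.
intros [H1 H2 H3 H4 H5 H6 H7 H8 H9 H10].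
split; intros s t Hs;
  try (replace (t + 2 * PI + c) with (t + c + 2 * PI) by ring; auto; fail);
  try (apply (is_derive_shift (fun y => v s y)); auto; fail);
  try (apply (is_derive_shift (fun y => vt s y)); auto; fail);
  try (apply continuity_2d_pt_shift; auto; fail); auto.
Qed.

Lemma is_derive_cos_coef (g gs : R -> R -> R) s0 n s :
  s0 < s ->
  (forall s t, s0 < s -> is_derive (fun x => g x t) s (gs s t)) ->
  (forall s t, s0 < s -> continuity_2d_pt g s t) ->
  (forall s t, s0 < s -> continuity_2d_pt gs s t) ->
  is_derive (fun x => cos_coef (g x) n) s (cos_coef (gs s) n).
Proof.
intros Hs Hd Hc Hcs.
assert (Hd' : forall x t, s0 < x ->
  is_derive (fun z => g z t * cos (INR n * t)) x (gs x t * cos (INR n * t))).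
{ intros x t Hx.
  apply (is_derive_ext (fun z => scal (cos (INR n * t)) (g z t))).
  - intros z. apply (Rmult_comm (cos (INR n * t))).
  - rewrite (Rmult_comm (gs x t)). apply (is_derive_scal (fun z => g z t)). now apply Hd. }
assert (Hloc : locally s (fun x => s0 < x)) by (apply (open_gt s0); exact Hs).
unfold cos_coef.
replace (RInt (fun t => gs s t * cos (INR n * t)) (- PI) PI)
  with (RInt (fun t => Derive (fun z => g z t * cos (INR n * t)) s) (- PI) PI)
  by (apply RInt_ext; intros t _; apply is_derive_unique; now apply Hd').
apply (is_derive_RInt_param (fun x t => g x t * cos (INR n * t))).
- revert Hloc; apply filter_imp. intros x Hx t _.
  exists (gs x t * cos (INR n * t)). now apply Hd'.
- intros t _. apply continuity_2d_pt_ext_loc with (fun x t => gs x t * cos (INR n * t)).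
  + assert (He : 0 < s - s0) by lra. exists (mkposreal _ He). intros x y Hx _.
    simpl in Hx. apply Rabs_def2 in Hx. symmetry. apply is_derive_unique, Hd'. lra.
  + apply continuity_2d_pt_mult; [now apply Hcs|].
    apply (continuity_1d_2d_pt_comp (fun y => cos (INR n * y)) (fun _ v => v)).
    * apply continuity_pt_filterlim. apply continuous_cos_mult.
    * apply continuity_2d_pt_id2.
- revert Hloc; apply filter_imp. intros x Hx. apply ex_RInt_cont. intros t.
  apply continuous_Rmult; [|apply continuous_cos_mult].
  now apply continuity_2d_pt_snd, Hc.
Qed.

Lemma cos_coef_second_derivative (f f' f'' : R -> R) n :
  (forall t, is_derive f t (f' t)) -> (forall t, is_derive f' t (f'' t)) ->
  (forall t, continuous f'' t) ->
  f PI = f (- PI) -> f' PI = f' (- PI) ->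
  cos_coef f'' n = - INR n ^ 2 * cos_coef f n.
Proof.
intros H1 H2 H3 E E'.
assert (Hcf : forall t, continuous f t)
  by (intros; apply (ex_derive_continuous (V := R_NormedModule)); eexists; apply H1).
assert (I : is_RInt (fun t => f'' t * cos (INR n * t) + INR n ^ 2 * (f t * cos (INR n * t)))
  (- PI) PI 0).
(* Two integrations by parts in one primitive: F' = f'' cos (n t) + n^2 f cos (n t). At the
   endpoints the sine vanishes and the [f'] terms cancel by periodicity. *)
{ pose (F := fun t => f' t * cos (INR n * t) + INR n * (f t * sin (INR n * t))).
  replace 0 with (minus (F PI) (F (- PI))).
  - apply (is_RInt_derive (V := R_CompleteNormedModule)).
    + intros x _. unfold F. auto_derive.
      * split; [eexists; apply H2|split; [eexists; apply H1|auto]].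
      * rewrite (is_derive_unique (fun y : R => f y) _ _ (H1 x)), (is_derive_unique (fun y : R => f' y) _ _ (H2 x)). ring.
    + intros x _. apply continuous_Rplus.
      * apply continuous_Rmult; [auto|apply continuous_cos_mult].
      * apply continuous_Rmult; [apply continuous_const|].
        apply continuous_Rmult; [auto|apply continuous_cos_mult].
  - unfold F. replace (INR n * - PI) with (- (INR n * PI)) by ring.
    rewrite sin_neg, cos_neg, sin_INR_PI, E, E'. unfold minus, plus, opp; simpl. ring. }
apply (is_RInt_unique (V := R_CompleteNormedModule)) in I. rewrite RInt_Rplus, RInt_Rscal in I.
- unfold cos_coef. simpl in I |- *. lra.
- intros; apply continuous_Rmult; [auto|apply continuous_cos_mult].
- intros; apply continuous_Rmult; [auto|apply continuous_cos_mult].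
- intros; apply continuous_Rmult; [apply continuous_const|].
  apply continuous_Rmult; [auto|apply continuous_cos_mult].
Qed.

Lemma cos_coef_plus f g n :
  (forall x, continuous f x) -> (forall x, continuous g x) ->
  cos_coef (fun t => f t + g t) n = cos_coef f n + cos_coef g n.
Proof.
intros Hf Hg. unfold cos_coef.
rewrite <- RInt_Rplus by (intros; apply continuous_Rmult; [auto|apply continuous_cos_mult]).
apply RInt_ext. intros; simpl; ring.
Qed.

Lemma cos_coef_bound f n c :
  (forall x, continuous f x) -> (forall t, - PI <= t <= PI -> Rabs (f t) <= c) ->
  Rabs (cos_coef f n) <= 2 * PI * c.
Proof.
intros Hf Hc. generalize PI_RGT_0; intros Hpi. unfold cos_coef.
replace (2 * PI * c) with ((PI - - PI) * c) by ring.
apply abs_RInt_le_const; [lra| |].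
- apply ex_RInt_cont. intros; apply continuous_Rmult; [auto|apply continuous_cos_mult].
- intros t Ht. rewrite Rabs_mult. specialize (Hc t Ht).
  assert (Rabs (cos (INR n * t)) <= 1) by (apply Rabs_le; apply COS_bound).
  generalize (Rabs_pos (f t)) (Rabs_pos (cos (INR n * t))). nra.
Qed.

(* Positivity of [c - f] bounds all coefficients by the mean: integrate
   [(c - f) (1 +- cos)]. *)
Lemma cos_coef_le_mean f n c :
  (forall x, continuous f x) -> (forall t, - PI <= t <= PI -> f t <= c) -> (0 < n)%nat ->
  Rabs (cos_coef f n) <= 2 * PI * c - RInt f (- PI) PI.
Proof.
intros Hf Hc Hn. generalize PI_RGT_0; intros Hpi.
assert (Hcos : forall x, continuous (fun t => cos (INR n * t)) x)
  by (intros; apply continuous_cos_mult).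
assert (Hct : forall x, continuous (fun t : R => c) x) by (intros; apply continuous_const).
assert (Hfc : forall x, continuous (fun t => f t * cos (INR n * t)) x)
  by (intros; now apply continuous_Rmult).
assert (Hcc : forall x, continuous (fun t => c * cos (INR n * t)) x)
  by (intros; now apply continuous_Rmult).
assert (I0 : RInt (fun t => c * cos (INR n * t)) (- PI) PI = 0)
  by (now apply (cos_coef_const c n)).
assert (P : 0 <= RInt (fun t => (c - f t) + (c * cos (INR n * t) - f t * cos (INR n * t))) (- PI) PI).
{ apply RInt_ge_0; [lra| |].
  - apply ex_RInt_cont. intros; apply continuous_Rplus; apply continuous_Rminus; auto.
  - intros t Ht. specialize (Hc t ltac:(lra)). generalize (COS_bound (INR n * t)). nra. }
assert (Q : 0 <= RInt (fun t => (c - f t) - (c * cos (INR n * t) - f t * cos (INR n * t))) (- PI) PI).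
{ apply RInt_ge_0; [lra| |].
  - apply ex_RInt_cont. intros; apply continuous_Rminus; apply continuous_Rminus; auto.
  - intros t Ht. specialize (Hc t ltac:(lra)). generalize (COS_bound (INR n * t)). nra. }
rewrite RInt_Rplus, !RInt_Rminus, I0, RInt_Rconst in P; auto;
  try (intros; now apply continuous_Rminus).
rewrite !RInt_Rminus, I0, RInt_Rconst in Q; auto;
  try (intros; now apply continuous_Rminus).
unfold cos_coef. apply Rabs_le. lra.
Qed.

(** At most linear growth excludes the mode exp (sqrt m s). The strip principle is used for
    functions constant in t, with a quadratic penalty of weight [eps] that beats the linear growth;
    then [eps] tends to 0. *)
Lemma ode_bound_le (a a' a'' : R -> R) s0 s1 m B P Q :
  s0 < s1 -> 1 <= m -> 0 <= P -> 0 <= Q ->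
  (forall s, s0 < s -> is_derive a s (a' s)) ->
  (forall s, s0 < s -> is_derive a' s (a'' s)) ->
  (forall s, s1 <= s -> m * a s - B <= a'' s) ->
  a s1 <= B / m ->
  (forall s, s1 <= s -> a s <= P + Q * (s - s1)) ->
  0 <= B ->
  forall s, s1 <= s -> a s <= B / m.
Proof.
intros H01 Hm HP HQ Ha Ha' Hode Hs1 Hgrow HB s Hs.
assert (HBm : 0 <= B / m) by (apply Rdiv_le_0_compat; lra).
assert (Key : forall eps, 0 < eps -> a s - B / m - eps * (s - s1 + 2) ^ 2 <= 0).
{ intros eps Heps.
  (* Far enough that eps (s2 - s1) >= P + Q, whence the penalty at [s2] exceeds P + Q (s2 - s1). *)
  set (s2 := Rmax s (s1 + (P + Q) / eps + 1)).
  assert (Hs2 : s <= s2 /\ s1 + (P + Q) / eps + 1 <= s2)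
    by (split; [apply Rmax_l|apply Rmax_r]).
  assert (HPQ : 0 <= (P + Q) / eps) by (apply Rdiv_le_0_compat; lra).
  apply (strip_maximum_principle
    (fun s _ => a s - B / m - eps * (s - s1 + 2) ^ 2)
    (fun s _ => a' s - eps * (2 * (s - s1 + 2))) (fun _ _ => 0)
    (fun s _ => a'' s - eps * 2) (fun _ _ => 0) s0 s1 s2) with (t := 0);
    try lra.
  - intros x y Hx. apply continuity_2d_pt_minus.
    + apply (continuity_1d_2d_pt_comp (fun x => a x - B / m) (fun u _ => u));
        [|apply continuity_2d_pt_id1].
      apply continuity_pt_filterlim. apply (continuous_Rminus a (fun _ => B / m)); [|apply continuous_const].
      apply (ex_derive_continuous (V := R_NormedModule)). eexists; now apply Ha.
    + apply (continuity_1d_2d_pt_comp (fun x => eps * (x - s1 + 2) ^ 2) (fun u _ => u));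
        [|apply continuity_2d_pt_id1].
      apply continuity_pt_filterlim.
      apply (ex_derive_continuous (V := R_NormedModule)
        (fun x => eps * (x - s1 + 2) ^ 2)). auto_derive. auto.
  - intros; reflexivity.
  - intros x _ Hx. auto_derive; [eexists; now apply Ha|].
    rewrite (is_derive_unique (fun y : R => a y) _ _ (Ha x Hx)). ring.
  - intros x _ Hx. auto_derive; [eexists; now apply Ha'|].
    rewrite (is_derive_unique (fun y : R => a' y) _ _ (Ha' x Hx)). ring.
  - intros; apply (is_derive_const (K := R_AbsRing) (V := R_NormedModule)).
  - intros; apply (is_derive_const (K := R_AbsRing) (V := R_NormedModule)).
  - intros _ _. simpl. nra.
  - intros _ _. specialize (Hgrow s2 ltac:(lra)).
    assert (E : (P + Q) = eps * ((P + Q) / eps)) by (field; lra).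
    set (z := (P + Q) / eps) in *.
    assert (P + Q <= eps * (s2 - s1)) by nra.
    assert (P + Q * (s2 - s1) <= (P + Q) * (s2 - s1 + 2)) by nra.
    assert ((P + Q) * (s2 - s1 + 2) <= eps * (s2 - s1 + 2) ^ 2) by nra.
    lra.
  - intros x _ Hx _ Hpos.
    specialize (Hode x ltac:(lra)).
    assert (m * (B / m + eps * (x - s1 + 2) ^ 2) < m * a x)
      by (apply Rmult_lt_compat_l; lra).
    assert (m * (B / m + eps * (x - s1 + 2) ^ 2) = B + m * (eps * (x - s1 + 2) ^ 2))
      by (field; lra).
    (* The shift by 2 in the penalty is used here: [m] times the penalty is at least [4 * eps], more
       than its second derivative [2 * eps]. *)
    assert (4 <= (x - s1 + 2) ^ 2) by nra.
    assert (4 * eps <= eps * (x - s1 + 2) ^ 2) by nra.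
    assert (4 * eps <= m * (eps * (x - s1 + 2) ^ 2)) by nra.
    lra.
  - generalize PI_RGT_0; lra. }
apply le_epsilon. intros e He.
assert (Hsq : 0 < (s - s1 + 2) ^ 2) by nra.
assert (K := Key (e / (s - s1 + 2) ^ 2) ltac:(now apply Rdiv_lt_0_compat)).
replace (e / (s - s1 + 2) ^ 2 * (s - s1 + 2) ^ 2) with e in K by (field; nra).
lra.
Qed.

(** * Oscillation on circles *)


Lemma RInt_shift (f : R -> R) a b c : (forall x, continuous f x) ->
  RInt (fun t => f (t + c)) a b = RInt f (a + c) (b + c).
Proof.
intros Hf.
assert (H := RInt_comp_lin (V := R_CompleteNormedModule) f 1 c a b
  (ex_RInt_cont f _ _ Hf)).
rewrite !Rmult_1_l in H. rewrite <- H. apply RInt_ext. intros x _.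
change (f (x + c) = 1 * f (1 * x + c)). now rewrite !Rmult_1_l.
Qed.

Lemma RInt_periodic_shift (f : R -> R) c : (forall x, continuous f x) ->
  (forall t, f (t + 2 * PI) = f t) ->
  RInt (fun t => f (t + c)) (- PI) PI = RInt f (- PI) PI.
Proof.
intros Hf Hp. rewrite RInt_shift by auto.
assert (Ch : forall a b d, RInt f a b + RInt f b d = RInt f a d)
  by (intros; apply (RInt_Chasles (V := R_CompleteNormedModule)); now apply ex_RInt_cont).
assert (E : RInt f (- PI + c) (- PI) = RInt f (PI + c) PI).
{ rewrite <- (RInt_ext (fun t => f (t + 2 * PI)) f (- PI + c)) by auto.
  rewrite RInt_shift by auto. f_equal; ring. }
rewrite <- (Ch (- PI + c) (- PI) (PI + c)), E.
rewrite <- (Ch (- PI) (PI + c) PI). apply Rplus_comm.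
Qed.

Lemma cos_coef_0 f : cos_coef f 0 = RInt f (- PI) PI.
Proof.
apply RInt_ext. intros t _. simpl. rewrite Rmult_0_l, cos_0. apply Rmult_1_r.
Qed.

Lemma convex_above_tangent (a a' a'' : R -> R) s0 s1 s :
  s0 < s1 ->
  (forall s, s0 < s -> is_derive a s (a' s)) ->
  (forall s, s0 < s -> is_derive a' s (a'' s)) ->
  (forall s, s1 <= s -> 0 <= a'' s) ->
  s1 <= s -> a s1 + a' s1 * (s - s1) <= a s.
Proof.
intros H01 Ha Ha' Hpos Hs.
assert (M : forall x, s1 <= x -> a' s1 <= a' x).
{ intros x [Hx|<-]; [|lra].
  destruct (MVT_cor2 a' a'' s1 x Hx) as [c [Ec Hc]].
  - intros y Hy. apply is_derive_Reals, Ha'. lra.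
  - specialize (Hpos c ltac:(lra)). nra. }
destruct Hs as [Hs|<-]; [|lra].
destruct (MVT_cor2 a a' s1 s Hs) as [c [Ec Hc]].
- intros y Hy. apply is_derive_Reals, Ha. lra.
- specialize (M c ltac:(lra)). nra.
Qed.

Lemma cyl_cont_snd s0 v vs vt vss vtt s :
  cyl_C2 s0 v vs vt vss vtt -> s0 < s ->
  (forall t, continuous (v s) t) /\ (forall t, continuous (vss s) t) /\
  (forall t, continuous (vtt s) t).
Proof.
intros Hv Hs. repeat split; intros t; apply continuity_2d_pt_snd;
  [eapply cyl_c|eapply cyl_css|eapply cyl_ctt]; eassumption.
Qed.

Lemma cos_coef_vtt s0 v vs vt vss vtt n s :
  cyl_C2 s0 v vs vt vss vtt -> s0 < s ->
  cos_coef (vtt s) n = - INR n ^ 2 * cos_coef (v s) n.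
Proof.
intros Hv Hs. apply cos_coef_second_derivative with (vt s).
- intros t. now apply (cyl_dt _ _ _ _ _ _ Hv).
- intros t. now apply (cyl_dtt _ _ _ _ _ _ Hv).
- now apply (cyl_cont_snd _ _ _ _ _ _ s Hv).
- rewrite <- (cyl_per _ _ _ _ _ _ Hv s (- PI) Hs). f_equal; ring.
- rewrite <- (cyl_per_t _ _ _ _ _ _ Hv s (- PI) Hs). f_equal; ring.
Qed.

(* Each Fourier coefficient solves [a'' = n^2 a + g] with [g] bounded and grows
   at most linearly, so it is [O(1/n^2)] uniformly in [s]. *)
Lemma cyl_cos_coef_decay s0 v vs vt vss vtt s1 c1 c2 c3 p q n :
  cyl_C2 s0 v vs vt vss vtt -> s0 < s1 -> 0 <= p -> 0 <= q ->
  (forall s t, s1 <= s -> - PI <= t <= PI -> 0 <= vss s t + vtt s t <= c1) ->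
  (forall s t, s1 <= s -> - PI <= t <= PI -> v s t <= c2) ->
  (forall t, - PI <= t <= PI -> Rabs (vtt s1 t) <= c3) ->
  (forall s, s1 <= s -> 2 * PI * c2 - RInt (v s) (- PI) PI <= p + q * (s - s1)) ->
  (0 < n)%nat ->
  forall s, s1 <= s -> Rabs (cos_coef (v s) n) <= 2 * PI * Rmax c1 c3 / INR n ^ 2.
Proof.
intros Hv H01 Hp Hq Hlap Hub Hb Hgrow Hn.
generalize PI_RGT_0; intros Hpi.
assert (Hn1 : 1 <= INR n) by (apply (le_INR 1); lia).
assert (Hc3 : 0 <= c3) by (eapply Rle_trans; [apply Rabs_pos|apply (Hb 0); lra]).
assert (Hmax : 0 <= Rmax c1 c3) by (eapply Rle_trans; [apply Hc3|apply Rmax_r]).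
assert (Hd1 : forall s, s0 < s -> is_derive (fun x => cos_coef (v x) n) s (cos_coef (vs s) n)).
{ intros s Hs. apply (is_derive_cos_coef v vs s0); auto; apply Hv. }
assert (Hd2 : forall s, s0 < s -> is_derive (fun x => cos_coef (vs x) n) s (cos_coef (vss s) n)).
{ intros s Hs. apply (is_derive_cos_coef vs vss s0); auto; apply Hv. }
assert (Hode : forall s, s1 <= s ->
  Rabs (cos_coef (vss s) n - INR n ^ 2 * cos_coef (v s) n) <= 2 * PI * Rmax c1 c3).
{ intros s Hs. destruct (cyl_cont_snd _ _ _ _ _ _ s Hv ltac:(lra)) as [C1 [C2 C3]].
  replace (cos_coef (vss s) n - INR n ^ 2 * cos_coef (v s) n)
    with (cos_coef (fun t => vss s t + vtt s t) n).
  - apply cos_coef_bound.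
    + intros; now apply continuous_Rplus.
    + intros t Ht. specialize (Hlap s t Hs Ht). rewrite Rabs_pos_eq by lra.
      generalize (Rmax_l c1 c3); lra.
  - rewrite cos_coef_plus, (cos_coef_vtt _ _ _ _ _ _ n s Hv) by (auto; lra). ring. }
(* On the initial circle the decay comes from the coefficient of [vtt], which is - n^2 times that of
   [v]; hence [c3] beside [c1] in the bound. *)
assert (Hinit : Rabs (cos_coef (v s1) n) <= 2 * PI * Rmax c1 c3 / INR n ^ 2).
{ destruct (cyl_cont_snd _ _ _ _ _ _ s1 Hv H01) as [C1 [C2 C3]].
  assert (T := cos_coef_bound (vtt s1) n c3 C3 Hb).
  rewrite (cos_coef_vtt _ _ _ _ _ _ n s1 Hv H01), Rabs_mult, Rabs_Ropp in T.
  rewrite (Rabs_pos_eq (INR n ^ 2)) in T by nra.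
  apply Rmult_le_reg_l with (INR n ^ 2); [nra|].
  replace (INR n ^ 2 * (2 * PI * Rmax c1 c3 / INR n ^ 2)) with (2 * PI * Rmax c1 c3)
    by (field; lra).
  generalize (Rmax_r c1 c3). nra. }
assert (Hg : forall s, s1 <= s -> Rabs (cos_coef (v s) n) <= p + q * (s - s1)).
{ intros s Hs. eapply Rle_trans; [|now apply Hgrow].
  apply cos_coef_le_mean; auto. apply (cyl_cont_snd _ _ _ _ _ _ s Hv); lra. }
intros s Hs. apply Rabs_le_between in Hinit. apply Rabs_le. split.
- assert (T := ode_bound_le (fun s => - cos_coef (v s) n) (fun s => - cos_coef (vs s) n)
    (fun s => - cos_coef (vss s) n) s0 s1 (INR n ^ 2) (2 * PI * Rmax c1 c3) p q).
  enough (- cos_coef (v s) n <= 2 * PI * Rmax c1 c3 / INR n ^ 2) by lra.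
  apply T; auto; try nra.
  + intros x Hx. apply (is_derive_opp (fun x => cos_coef (v x) n)). now apply Hd1.
  + intros x Hx. apply (is_derive_opp (fun x => cos_coef (vs x) n)). now apply Hd2.
  + intros x Hx. specialize (Hode x Hx). apply Rabs_le_between in Hode. lra.
  + intros x Hx. specialize (Hg x Hx). apply Rabs_le_between in Hg. lra.
- apply (ode_bound_le (fun s => cos_coef (v s) n) (fun s => cos_coef (vs s) n)
    (fun s => cos_coef (vss s) n) s0 s1 (INR n ^ 2) (2 * PI * Rmax c1 c3) p q); auto; try nra.
  + intros x Hx. specialize (Hode x Hx). apply Rabs_le_between in Hode. lra.
  + intros x Hx. specialize (Hg x Hx). apply Rabs_le_between in Hg. lra.
Qed.

Lemma cyl_angular_oscillation s0 v vs vt vss vtt s1 c1 c2 :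
  cyl_C2 s0 v vs vt vss vtt -> s0 < s1 ->
  (forall s t, s1 <= s -> -2 * PI <= t <= 2 * PI -> 0 <= vss s t + vtt s t <= c1) ->
  (forall s t, s1 <= s -> -2 * PI <= t <= 2 * PI -> v s t <= c2) ->
  exists d, forall s t, s1 <= s -> - PI <= t <= PI ->
    Rabs (RInt (v s) (- PI) PI - 2 * PI * v s t) <= d.
Proof.
intros Hv H01 Hlap Hub. generalize PI_RGT_0; intros Hpi.
assert (Hc3 : exists c3, forall t, -2 * PI <= t <= 2 * PI -> Rabs (vtt s1 t) <= c3).
{ destruct (continuity_ab_maj (fun t => Rabs (vtt s1 t)) (-2 * PI) (2 * PI))
    as [m [Hm _]]; [lra| |now exists (Rabs (vtt s1 m))].
  intros t _. apply continuity_pt_filterlim.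
  apply (continuous_comp (vtt s1) Rabs).
  - now apply (cyl_cont_snd _ _ _ _ _ _ s1 Hv).
  - apply continuity_pt_filterlim, Rcontinuity_abs. }
destruct Hc3 as [c3 Hc3].
set (p := Rabs (2 * PI * c2 - cos_coef (v s1) 0)).
set (q := Rabs (cos_coef (vs s1) 0)).
(* A nonnegative Laplacian makes the mean convex, so it stays above its tangent at [s1]; the
   quantity that dominates all coefficients therefore grows at most linearly. *)
assert (Hgrow : forall s, s1 <= s -> 2 * PI * c2 - RInt (v s) (- PI) PI <= p + q * (s - s1)).
{ intros s Hs. rewrite <- cos_coef_0.
  assert (T := convex_above_tangent (fun s => cos_coef (v s) 0) (fun s => cos_coef (vs s) 0)
    (fun s => cos_coef (vss s) 0) s0 s1 s H01).
  cut (cos_coef (v s1) 0 + cos_coef (vs s1) 0 * (s - s1) <= cos_coef (v s) 0).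
  - intros U. unfold p, q.
    generalize (Rle_abs (2 * PI * c2 - cos_coef (v s1) 0)).
    generalize (Rle_abs (- cos_coef (vs s1) 0)). rewrite Rabs_Ropp. nra.
  - apply T; auto.
    + intros x Hx. apply (is_derive_cos_coef v vs s0); auto; apply Hv.
    + intros x Hx. apply (is_derive_cos_coef vs vss s0); auto; apply Hv.
    + intros x Hx. destruct (cyl_cont_snd _ _ _ _ _ _ x Hv ltac:(lra)) as [C1 [C2 C3]].
      assert (E := cos_coef_plus (vss x) (vtt x) 0 C2 C3).
      rewrite (cos_coef_vtt _ _ _ _ _ _ 0 x Hv) in E by lra. simpl in E.
      replace (cos_coef (vss x) 0) with (cos_coef (fun t => vss x t + vtt x t) 0) by lra.
      rewrite cos_coef_0. apply RInt_ge_0; [lra| |].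
      * apply ex_RInt_cont. intros; now apply continuous_Rplus.
      * intros t Ht. apply Hlap; lra. }
exists (4 * (2 * PI * Rmax c1 c3) + 2 * PI).
intros s t Hs Ht.
destruct (cyl_cont_snd _ _ _ _ _ _ s Hv ltac:(lra)) as [C1 _].
assert (Hper : forall x, v s (x + 2 * PI) = v s x) by (intros; apply Hv; lra).
(* Rotation by [t] carries the angle [t] to 0 and preserves the mean. Since it moves [-pi, pi]
   inside [-2 pi, 2 pi], the rotated function satisfies the same bounds there. *)
rewrite <- (RInt_periodic_shift (v s) t C1 Hper).
assert (Hr := cyl_C2_rotate _ _ _ _ _ _ t Hv).
replace (v s t) with (v s (0 + t)) by (f_equal; ring).
apply (mean_deviation_le (fun x => v s (x + t))).
- now apply (cyl_cont_snd _ _ _ _ _ _ s Hr ltac:(lra)).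
- assert (0 <= c3) by (eapply Rle_trans; [apply Rabs_pos|apply (Hc3 0); lra]).
  generalize (Rmax_r c1 c3). nra.
- intros k Hk.
  apply (cyl_cos_coef_decay s0 _ _ _ _ _ s1 c1 c2 c3 p q k Hr); auto;
    try apply Rabs_pos.
  + intros x y Hx Hy. apply Hlap; lra.
  + intros x y Hx Hy. apply Hub; lra.
  + intros y Hy. apply Hc3; lra.
  + intros x Hx. rewrite RInt_periodic_shift; auto.
    * now apply (cyl_cont_snd _ _ _ _ _ _ x Hv ltac:(lra)).
    * intros; apply Hv; lra.
Qed.

(** * Barriers *)


Lemma cyl_C2_weaken s0 s0' v vs vt vss vtt :
  s0 <= s0' -> cyl_C2 s0 v vs vt vss vtt -> cyl_C2 s0' v vs vt vss vtt.
Proof.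
intros Hle [H1 H2 H3 H4 H5 H6 H7 H8 H9 H10].
split; intros s t Hs; assert (s0 < s) by lra; auto.
Qed.

(** Subtracting eps s makes the function nonpositive on a far circle without changing second
    derivatives; [eps] then tends to 0 at a fixed point. The factor [a] is 1 with [phi] minus an
    upper barrier, and -1 with [phi] a lower barrier. *)
Lemma strip_comparison s0 v vs vt vss vtt a phi phi' phi'' s1 :
  cyl_C2 s0 v vs vt vss vtt -> s0 < s1 -> 0 <= s1 ->
  (forall s, s0 < s -> is_derive phi s (phi' s)) ->
  (forall s, s0 < s -> is_derive phi' s (phi'' s)) ->
  (forall s t, s1 < s -> -2 * PI <= t <= 2 * PI -> 0 < a * v s t + phi s ->
     0 < a * (vss s t + vtt s t) + phi'' s) ->
  (forall t, -2 * PI <= t <= 2 * PI -> a * v s1 t + phi s1 <= 0) ->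
  (forall eps, 0 < eps -> exists s2, forall s t, s2 <= s -> -2 * PI <= t <= 2 * PI ->
     a * v s t + phi s <= eps * s) ->
  forall s t, s1 <= s -> -2 * PI <= t <= 2 * PI -> a * v s t + phi s <= 0.
Proof.
intros Hv H01 Hs1 Hphi Hphi' Hsub Hinit Hgrow s t Hs Ht.
apply le_epsilon. intros e He. rewrite Rplus_0_l.
set (eps := e / (s + 1)).
assert (Heps : 0 < eps) by (apply Rdiv_lt_0_compat; lra).
assert (Hes : eps * s <= e).
{ unfold eps. apply Rmult_le_reg_r with (s + 1); [lra|]. field_simplify; nra. }
destruct (Hgrow eps Heps) as [S HS].
cut (a * v s t + phi s - eps * s <= 0); [lra|].
apply (strip_maximum_principle
  (fun s t => a * v s t + phi s - eps * s)
  (fun s t => a * vs s t + phi' s - eps) (fun s t => a * vt s t)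
  (fun s t => a * vss s t + phi'' s) (fun s t => a * vtt s t) s0 s1 (Rmax s S));
  auto.
- apply Rle_trans with s; [exact Hs|apply Rmax_l].
- intros x y Hx. apply continuity_2d_pt_minus.
  + apply continuity_2d_pt_plus.
    * apply continuity_2d_pt_mult; [apply continuity_2d_pt_const|now apply Hv].
    * apply (continuity_1d_2d_pt_comp phi (fun u _ => u)); [|apply continuity_2d_pt_id1].
      apply continuity_pt_filterlim.
      apply (ex_derive_continuous (V := R_NormedModule)). eexists; now apply Hphi.
  + apply continuity_2d_pt_mult; [apply continuity_2d_pt_const|apply continuity_2d_pt_id1].
- intros x y Hx. now rewrite (cyl_per _ _ _ _ _ _ Hv x y Hx).
- intros x y Hx. assert (D := cyl_ds _ _ _ _ _ _ Hv x y Hx).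
  auto_derive.
  + split; [eexists; exact D|split; [eexists; now apply Hphi|auto]].
  + rewrite (is_derive_unique (fun x : R => v x y) _ _ D),
      (is_derive_unique (fun x : R => phi x) _ _ (Hphi x Hx)). ring.
- intros x y Hx. assert (D := cyl_dss _ _ _ _ _ _ Hv x y Hx).
  auto_derive.
  + split; [eexists; exact D|split; [eexists; now apply Hphi'|auto]].
  + rewrite (is_derive_unique (fun x : R => vs x y) _ _ D),
      (is_derive_unique (fun x : R => phi' x) _ _ (Hphi' x Hx)). ring.
- intros x y Hx. assert (D := cyl_dt _ _ _ _ _ _ Hv x y Hx).
  auto_derive.
  + eexists; exact D.
  + rewrite (is_derive_unique (fun y : R => v x y) _ _ D). ring.
- intros x y Hx. assert (D := cyl_dtt _ _ _ _ _ _ Hv x y Hx).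
  auto_derive.
  + eexists; exact D.
  + rewrite (is_derive_unique (fun y : R => vt x y) _ _ D). ring.
- intros y Hy. specialize (Hinit y Hy). nra.
- intros y Hy. specialize (HS (Rmax s S) y (Rmax_r _ _) Hy). lra.
- intros x y Hx Hy Hpos. specialize (Hsub x y ltac:(lra) Hy). nra.
- split; [exact Hs|apply Rmax_l].
Qed.

Lemma exp_m_ln x : 0 < x -> exp (- ln x) = / x.
Proof. intros. now rewrite exp_Ropp, exp_ln. Qed.

(** For y = 0 the right side is the second derivative of - ln r, with r a translate of s: the exact
    solution. The factor exp (2 y) records the effect of a correction y. *)
Lemma exp_barrier (r k y : R) : 0 < r -> 0 < k ->
  k * exp (2 * (- ln r - ln k / 2 + y)) = exp (2 * y) / r ^ 2.
Proof.
intros Hr Hk.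
replace (2 * (- ln r - ln k / 2 + y)) with (- ln r + - ln r + - ln k + 2 * y) by field.
rewrite !exp_plus, !exp_m_ln by assumption. field; lra.
Qed.

Lemma ln_le_affine eps s : 0 < eps -> 0 < s -> ln s <= eps * s - ln eps.
Proof.
intros He Hs. assert (H := exp_ineq1_le (ln (eps * s))).
rewrite exp_ln, ln_mult in H by (try apply Rmult_lt_0_compat; assumption). lra.
Qed.

Lemma ln_shift_le s b : 0 < s -> 0 <= b -> ln (s + b) <= ln s + b / s.
Proof.
intros Hs Hb. assert (H := exp_ineq1_le (ln ((s + b) / s))).
assert (0 < (s + b) / s) by (apply Rdiv_lt_0_compat; lra).
rewrite exp_ln in H by assumption.
rewrite ln_div in H by lra.
replace ((s + b) / s) with (1 + b / s) in H by (field; lra). lra.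
Qed.

(** The exact solution blows up at [b], so placing [b] just below [S] lifts the barrier above [v] on
    the first circle. The correction [/ s] multiplies the nonlinear term by at least 1 + 2/s, which
    pays for its own second derivative and for the error in [K]. *)
Lemma cyl_upper_bound v vs vt vss vtt K k S :
  cyl_C2 0 v vs vt vss vtt -> 0 < k -> 5 <= S ->
  (forall s t, 0 < s -> vss s t + vtt s t = K s t * exp (2 * v s t)) ->
  (forall s t, S <= s -> Rabs (K s t - k) <= k / s ^ 3) ->
  (forall eps, 0 < eps -> exists s2, forall s t, s2 <= s -> v s t <= eps * s) ->
  exists b, 2 <= b < S /\ forall s t, S <= s -> -2 * PI <= t <= 2 * PI ->
    v s t <= - ln (s - b) - ln k / 2 + / s.
Proof.
intros Hv Hk HS Heq HK Hgrow. generalize PI_RGT_0; intros Hpi.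
destruct (continuity_ab_maj (v S) (-2 * PI) (2 * PI)) as [m [Hm _]]; [lra| |].
{ intros t _. apply continuity_pt_filterlim.
  apply (cyl_cont_snd _ _ _ _ _ _ S Hv). lra. }
(* The exponential makes - ln eta dominate v + (ln k)/2 on the circle s = S; the cap 1 keeps [b] at
   least S - 1 >= 4. *)
set (eta := Rmin 1 (exp (- v S m - ln k / 2))).
assert (Heta : 0 < eta <= 1).
{ split; [apply Rmin_pos; [lra|apply exp_pos]|apply Rmin_l]. }
assert (Hleta : ln eta <= - v S m - ln k / 2).
{ rewrite <- (ln_exp (- v S m - ln k / 2)). apply ln_le; [lra|apply Rmin_r]. }
set (b := S - eta). exists b. split; [unfold b; lra|].
assert (Hb : 2 <= b < S) by (unfold b; lra).
set (phi := fun s => - ln (s - b) - ln k / 2 + / s).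
intros s t Hs Ht.
cut (1 * v s t + (- phi s) <= 0); [unfold phi; lra|]. revert s t Hs Ht.
apply (strip_comparison b v vs vt vss vtt 1 (fun s => - phi s)
  (fun s => / (s - b) + / s ^ 2) (fun s => - (/ (s - b) ^ 2 + 2 / s ^ 3)) S).
- apply cyl_C2_weaken with 0; [lra|exact Hv].
- lra.
- lra.
- intros s Hs. unfold phi. auto_derive; [repeat split; lra|]. field; lra.
- intros s Hs. auto_derive; [repeat split; nra|]. field; lra.
- intros s t Hs Ht Hpos. rewrite Heq by lra.
  specialize (HK s t ltac:(lra)). apply Rabs_le_between in HK.
  assert (Hs3 : 0 < / s ^ 3 <= 1).
  { split; [apply Rinv_0_lt_compat; nra|]. rewrite <- Rinv_1. apply Rinv_le_contravar; nra. }
  assert (HKk : k * (1 - / s ^ 3) <= K s t) by (unfold Rdiv in HK; lra).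
  assert (He : exp (2 * phi s) < exp (2 * v s t)) by (apply exp_increasing; lra).
  assert (Hke : k * exp (2 * phi s) = exp (2 * / s) / (s - b) ^ 2)
    by (apply exp_barrier; lra).
  assert (Hes := exp_ineq1_le (2 * / s)).
  assert (Hb2 : 0 < (s - b) ^ 2) by nra.
  (* Multiplied by (s - b)^2, the gain 2/s cancels the leading part of 2 (s - b)^2 / s^3. The
     surplus 4 b / s^2 that remains has to cover the lower-order terms, and [2 <= b <= s]
     suffices. *)
  assert (Hmain : / (s - b) ^ 2 + 2 / s ^ 3 <= (1 - / s ^ 3) * ((1 + 2 * / s) / (s - b) ^ 2)).
  { assert (E : (1 - / s ^ 3) * ((1 + 2 * / s) / (s - b) ^ 2) - (/ (s - b) ^ 2 + 2 / s ^ 3)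
      = (4 * b * s ^ 2 - 2 * b ^ 2 * s - s - 2) / (s ^ 4 * (s - b) ^ 2)) by (field; lra).
    assert (0 <= (4 * b * s ^ 2 - 2 * b ^ 2 * s - s - 2) / (s ^ 4 * (s - b) ^ 2)); [|lra].
    apply Rdiv_le_0_compat; [|apply Rmult_lt_0_compat; [apply pow_lt; lra|exact Hb2]].
    assert (b ^ 2 * s <= b * s ^ 2) by nra. assert (2 * s ^ 2 <= b * s ^ 2) by nra. nra. }
  assert ((1 - / s ^ 3) * ((1 + 2 * / s) / (s - b) ^ 2)
     <= (1 - / s ^ 3) * (k * exp (2 * phi s))).
  { apply Rmult_le_compat_l; [lra|]. rewrite Hke. apply Rmult_le_compat_r; [|lra].
    apply Rlt_le, Rinv_0_lt_compat, Hb2. }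
  assert (P := exp_pos (2 * phi s)).
  assert (Hs3' : / s ^ 3 < 1).
  { rewrite <- Rinv_1. apply Rinv_lt_contravar; [nra|]. nra. }
  assert (0 < k * (1 - / s ^ 3)) by nra.
  assert (k * (1 - / s ^ 3) * exp (2 * phi s) < k * (1 - / s ^ 3) * exp (2 * v s t))
    by (apply Rmult_lt_compat_l; lra).
  assert (k * (1 - / s ^ 3) * exp (2 * v s t) <= K s t * exp (2 * v s t))
    by (apply Rmult_le_compat_r; [apply Rlt_le, exp_pos|lra]).
  nra.
- intros t Ht. specialize (Hm t Ht). unfold phi.
  replace (S - b) with eta by (unfold b; ring).
  assert (0 < / S) by (apply Rinv_0_lt_compat; lra). lra.
- intros eps Heps. destruct (Hgrow (eps / 2) ltac:(lra)) as [s2 Hs2].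
  (* The allowance eps s is split: one half for [v], a quarter for the logarithm, a quarter for the
     constants. *)
  exists (Rmax s2 (Rmax S (4 / eps * Rabs (- ln (eps / 4) + ln k / 2)))).
  intros s t Hs _.
  assert (H1 := Rmax_l s2 (Rmax S (4 / eps * Rabs (- ln (eps / 4) + ln k / 2)))).
  assert (H2 := Rmax_r s2 (Rmax S (4 / eps * Rabs (- ln (eps / 4) + ln k / 2)))).
  assert (H3 := Rmax_l S (4 / eps * Rabs (- ln (eps / 4) + ln k / 2))).
  assert (H4 := Rmax_r S (4 / eps * Rabs (- ln (eps / 4) + ln k / 2))).
  specialize (Hs2 s t ltac:(lra)).
  assert (L := ln_le_affine (eps / 4) s ltac:(lra) ltac:(lra)).
  assert (L' : ln (s - b) <= ln s) by (apply ln_le; lra).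
  assert (0 < / s) by (apply Rinv_0_lt_compat; lra).
  assert (A := Rle_abs (- ln (eps / 4) + ln k / 2)).
  set (z := Rabs _) in *.
  assert (z <= eps / 4 * s).
  { replace z with (eps / 4 * (4 / eps * z)) by (field; lra).
    apply Rmult_le_compat_l; lra. }
  unfold phi. lra.
Qed.

(** A large [b] sinks the barrier below [v] on the first circle. Since [b] may far exceed s, the
    correction lives on the scale s + 2 b: its second derivative then stays comparable to 1/(s +
    b)^2, whereas that of 1/s would not. *)
Lemma cyl_lower_bound v vs vt vss vtt K k S d :
  cyl_C2 0 v vs vt vss vtt -> 0 < k -> 5 <= S ->
  (forall s t, 0 < s -> vss s t + vtt s t = K s t * exp (2 * v s t)) ->
  (forall s t, S <= s -> Rabs (K s t - k) <= k / s ^ 3) ->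
  (forall eps, 0 < eps -> exists s2, forall s t, s2 <= s -> -2 * PI <= t <= 2 * PI ->
     - (eps * s) - d <= v s t) ->
  exists b, 1 <= b /\ forall s t, S <= s -> -2 * PI <= t <= 2 * PI ->
    - ln (s + b) - ln k / 2 - b / 2 / (s + 2 * b) <= v s t.
Proof.
intros Hv Hk HS Heq HK Hgrow. generalize PI_RGT_0; intros Hpi.
destruct (continuity_ab_min (v S) (-2 * PI) (2 * PI)) as [m [Hm _]]; [lra| |].
{ intros t _. apply continuity_pt_filterlim.
  apply (cyl_cont_snd _ _ _ _ _ _ S Hv). lra. }
set (b := Rmax 1 (exp (- v S m - ln k / 2))). exists b.
assert (Hb : 1 <= b) by apply Rmax_l. split; [exact Hb|].
assert (Hlb : - v S m - ln k / 2 <= ln (S + b)).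
{ rewrite <- (ln_exp (- v S m - ln k / 2)). apply ln_le; [apply exp_pos|].
  assert (exp (- v S m - ln k / 2) <= b) by apply Rmax_r. lra. }
set (psi := fun s => - ln (s + b) - ln k / 2 - b / 2 / (s + 2 * b)).
intros s t Hs Ht.
cut (-1 * v s t + psi s <= 0); [unfold psi; lra|]. revert s t Hs Ht.
apply (strip_comparison 0 v vs vt vss vtt (-1) psi
  (fun s => - / (s + b) + b / 2 / (s + 2 * b) ^ 2)
  (fun s => / (s + b) ^ 2 - b / (s + 2 * b) ^ 3) S).
- exact Hv.
- lra.
- lra.
- intros s Hs. unfold psi. auto_derive; [repeat split; lra|]. field; lra.
- intros s Hs. auto_derive; [repeat split; nra|]. field; lra.
- intros s t Hs Ht Hpos. rewrite Heq by lra.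
  specialize (HK s t ltac:(lra)). apply Rabs_le_between in HK.
  assert (Hs3 : 0 < / s ^ 3) by (apply Rinv_0_lt_compat, pow_lt; lra).
  assert (HKk : K s t <= k * (1 + / s ^ 3)) by (unfold Rdiv in HK; lra).
  assert (He : exp (2 * v s t) < exp (2 * psi s)) by (apply exp_increasing; lra).
  (* With 1 - tau = (s + b)/(s + 2 b), both sides of the differential inequality become functions of
     [tau] over (s + b)^2, apart from the error 1/s^3. *)
  set (tau := b / (s + 2 * b)).
  assert (Htau : 0 < tau <= / 2).
  { unfold tau. split; [apply Rdiv_lt_0_compat; lra|].
    apply Rmult_le_reg_r with (s + 2 * b); [lra|]. field_simplify; lra. }
  assert (Hke : k * exp (2 * psi s) = exp (- tau) / (s + b) ^ 2).
  { replace (psi s) with (- ln (s + b) - ln k / 2 + - (b / 2 / (s + 2 * b)))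
      by (unfold psi; ring).
    rewrite exp_barrier by lra. do 2 f_equal. unfold tau. field; lra. }
  assert (Het : exp (- tau) <= / (1 + tau)).
  { rewrite exp_Ropp. apply Rinv_le_contravar; [lra|apply exp_ineq1_le]. }
  (* [1 <= b] gives tau >= 1/(s + 2), and (s + 2)^2 <= s^3 for s >= 5. *)
  assert (Hst : / s ^ 3 <= tau ^ 2).
  { apply Rle_trans with ((/ (s + 2)) ^ 2).
    - rewrite pow_inv. apply Rinv_le_contravar; nra.
    - apply pow_incr. split; [apply Rlt_le, Rinv_0_lt_compat; lra|].
      unfold tau. apply Rmult_le_reg_r with ((s + 2) * (s + 2 * b)); [nra|].
      field_simplify; nra. }
  (* (1 + tau)(1 - tau (1 - tau)^2) = 1 + tau^2 + tau^3 - tau^4: the first-order terms cancel and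
     tau^2 absorbs 1/s^3. *)
  assert (Hmain : (1 + / s ^ 3) * / (1 + tau) <= 1 - tau * (1 - tau) ^ 2).
  { apply Rmult_le_reg_r with (1 + tau); [lra|].
    rewrite Rmult_assoc, Rinv_l by lra. nra. }
  assert (Hpsi : / (s + b) ^ 2 - b / (s + 2 * b) ^ 3
    = (1 - tau * (1 - tau) ^ 2) / (s + b) ^ 2) by (unfold tau; field; lra).
  assert (Hb2 : 0 < / (s + b) ^ 2) by (apply Rinv_0_lt_compat; nra).
  assert (U1 : K s t * exp (2 * v s t) <= k * (1 + / s ^ 3) * exp (2 * v s t))
    by (apply Rmult_le_compat_r; [apply Rlt_le, exp_pos|lra]).
  assert (U2 : k * (1 + / s ^ 3) * exp (2 * v s t) < k * (1 + / s ^ 3) * exp (2 * psi s))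
    by (apply Rmult_lt_compat_l; nra).
  assert (U3 : k * (1 + / s ^ 3) * exp (2 * psi s)
    = (1 + / s ^ 3) * exp (- tau) * / (s + b) ^ 2).
  { replace (k * (1 + / s ^ 3) * exp (2 * psi s))
      with ((1 + / s ^ 3) * (k * exp (2 * psi s))) by ring.
    rewrite Hke. unfold Rdiv. ring. }
  assert (U4 : (1 + / s ^ 3) * exp (- tau) <= 1 - tau * (1 - tau) ^ 2).
  { apply Rle_trans with ((1 + / s ^ 3) * / (1 + tau)); [|exact Hmain].
    apply Rmult_le_compat_l; lra. }
  assert (U5 := Rmult_le_compat_r _ _ _ (Rlt_le _ _ Hb2) U4).
  unfold Rdiv in Hpsi |- *. lra.
- intros t Ht. specialize (Hm t Ht). unfold psi.
  assert (0 < b / 2 / (S + 2 * b)) by (apply Rdiv_lt_0_compat; lra). lra.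
- intros eps Heps. destruct (Hgrow (eps / 2) ltac:(lra)) as [s2 Hs2].
  exists (Rmax s2 (Rmax S (2 / eps * Rabs (d - ln k / 2)))).
  intros s t Hs Ht.
  assert (H1 := Rmax_l s2 (Rmax S (2 / eps * Rabs (d - ln k / 2)))).
  assert (H2 := Rmax_r s2 (Rmax S (2 / eps * Rabs (d - ln k / 2)))).
  assert (H3 := Rmax_l S (2 / eps * Rabs (d - ln k / 2))).
  assert (H4 := Rmax_r S (2 / eps * Rabs (d - ln k / 2))).
  specialize (Hs2 s t ltac:(lra) Ht).
  assert (L' : 0 <= ln (s + b)) by (rewrite <- ln_1; apply ln_le; lra).
  assert (0 < b / 2 / (s + 2 * b)) by (apply Rdiv_lt_0_compat; lra).
  assert (A := Rle_abs (d - ln k / 2)).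
  set (z := Rabs _) in *.
  assert (z <= eps / 2 * s).
  { replace z with (eps / 2 * (2 / eps * z)) by (field; lra).
    apply Rmult_le_compat_l; lra. }
  unfold psi. lra.
Qed.

(** The upper bound has to come before the lower one: through the equation it also bounds the
    Laplacian, and both bounds feed the oscillation estimate on which the lower bound rests. *)
Lemma cyl_asymptotics v vs vt vss vtt K k S :
  cyl_C2 0 v vs vt vss vtt -> 0 < k -> 5 <= S ->
  (forall s t, 0 < s -> vss s t + vtt s t = K s t * exp (2 * v s t)) ->
  (forall s t, S <= s -> Rabs (K s t - k) <= k / s ^ 3) ->
  (forall eps, 0 < eps -> exists s2, forall s t, s2 <= s -> v s t <= eps * s) ->
  (forall eps, 0 < eps -> exists s2, forall s, s2 <= s ->
     exists t, - PI <= t <= PI /\ - (eps * s) <= v s t) ->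
  exists c s1, 0 <= c /\ forall s t, s1 <= s -> - PI <= t <= PI ->
    Rabs (v s t + ln s + ln k / 2) <= c / s.
Proof.
intros Hv Hk HS Heq HK Hup Hlo. generalize PI_RGT_0; intros Hpi.
destruct (cyl_upper_bound v vs vt vss vtt K k S) as [b [Hb Hvb]]; auto.
set (c2 := - ln (S - b) - ln k / 2 + 1).
assert (Hc2 : forall s t, S <= s -> -2 * PI <= t <= 2 * PI -> v s t <= c2).
{ intros s t Hs Ht. specialize (Hvb s t Hs Ht). unfold c2.
  assert (ln (S - b) <= ln (s - b)) by (apply ln_le; lra).
  assert (/ s <= 1) by (rewrite <- Rinv_1; apply Rinv_le_contravar; lra). lra. }
assert (HK' : forall s t, S <= s -> 0 <= K s t <= 2 * k).
{ intros s t Hs. specialize (HK s t Hs). apply Rabs_le_between in HK.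
  assert (k / s ^ 3 <= k).
  { apply Rmult_le_reg_r with (s ^ 3); [apply pow_lt; lra|]. field_simplify; [|lra].
    assert (1 <= s ^ 3) by (apply pow_R1_Rle; lra). nra. }
  lra. }
destruct (cyl_angular_oscillation 0 v vs vt vss vtt S (2 * k * exp (2 * c2)) c2) as [d Hd];
  auto; [lra| |].
{ intros s t Hs Ht. rewrite Heq by lra. specialize (HK' s t Hs).
  assert (P := exp_pos (2 * v s t)).
  assert (exp (2 * v s t) <= exp (2 * c2)).
  { specialize (Hc2 s t Hs Ht). destruct (Req_dec (v s t) c2) as [->|N]; [lra|].
    apply Rlt_le, exp_increasing. lra. }
  split; [nra|]. apply Rmult_le_compat; lra. }
destruct (cyl_lower_bound v vs vt vss vtt K k S (d / PI)) as [b' [Hb' Hvb']]; auto.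
{ intros eps Heps. destruct (Hlo eps Heps) as [s2 Hs2]. exists (Rmax S s2).
  intros s t Hs Ht.
  assert (HsS : S <= s) by (eapply Rle_trans; [apply Rmax_l|exact Hs]).
  assert (Hss2 : s2 <= s) by (eapply Rle_trans; [apply Rmax_r|exact Hs]).
  destruct (Hs2 s Hss2) as [t0 [Ht0 Hv0]].
  destruct (period_reduction (v s) t) as [t' [Ht' <-]];
    [intros; apply Hv; lra|exact Ht|].
  (* Passing from the good point [t0] to any other through the mean costs 2 d / (2 pi) = d / pi. *)
  assert (D0 := Hd s t0 HsS Ht0). assert (D1 := Hd s t' HsS Ht').
  apply Rabs_le_between in D0. apply Rabs_le_between in D1.
  assert (E : d = PI * (d / PI)) by (field; lra). set (z := d / PI) in *. nra. }
(* For s >= 2 S one has s - b >= s/2, so the shift by [b] costs 2 b / s and the upper correction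
   1/s; below, the shift by [b'] and the correction cost b'/s each. *)
exists (2 * b + 1 + 2 * b'), (2 * S). split; [lra|].
intros s t Hs Ht. assert (Hs' : S <= s) by lra.
specialize (Hvb s t Hs' ltac:(lra)). specialize (Hvb' s t Hs' ltac:(lra)).
assert (Hi : 0 < / s) by (apply Rinv_0_lt_compat; lra).
assert (L1 := ln_shift_le s b' ltac:(lra) ltac:(lra)).
assert (L2 := ln_shift_le (s - b) b ltac:(lra) ltac:(lra)).
replace (s - b + b) with s in L2 by ring.
assert (M1 : b / (s - b) <= 2 * b / s).
{ apply Rmult_le_reg_r with (s * (s - b)); [nra|]. field_simplify; nra. }
assert (M2 : b' / 2 / (s + 2 * b') <= b' / s).
{ apply Rmult_le_reg_r with (2 * s * (s + 2 * b')); [nra|]. field_simplify; nra. }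
unfold Rdiv in *. apply Rabs_le. nra.
Qed.

(** * Polar coordinates *)


Lemma locally_punctured_disk (z : C) : punctured_disk z -> locally z punctured_disk.
Proof.
intros [Hd Hz].
(* Neighbourhoods in [C] are squares, on which [Cmod] is controlled by twice the radius; hence the
   halves. *)
set (e1 := (1 - Cmod z) / 2). set (e2 := Cmod z / 2).
assert (Hz' : 0 < Cmod z) by now apply Cmod_gt_0.
assert (He : 0 < Rmin e1 e2).
{ unfold disk in Hd. apply Rmin_pos; unfold e1, e2; lra. }
exists (mkposreal _ He). intros y [Hy1 Hy2].
change (Rabs (fst y - fst z) < Rmin e1 e2) in Hy1.
change (Rabs (snd y - snd z) < Rmin e1 e2) in Hy2.
assert (Hyz : Cmod (y - z)%C < 2 * Rmin e1 e2).
{ assert (T := Cmod_triangle (RtoC (fst y - fst z)) (Ci * RtoC (snd y - snd z))%C).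
  replace (RtoC (fst y - fst z) + Ci * RtoC (snd y - snd z))%C with (y - z)%C in T.
  - rewrite Cmod_mult, !Cmod_R in T.
    replace (Cmod Ci) with 1 in T.
    + lra.
    + unfold Cmod; simpl. replace (0 * (0 * 1) + 1 * (1 * 1)) with 1 by ring.
      now rewrite sqrt_1.
  - destruct y, z. unfold Cminus, Cplus, Cmult, Copp, RtoC, Ci; simpl. f_equal; ring. }
assert (M1 := Rmin_l e1 e2). assert (M2 := Rmin_r e1 e2).
split.
- unfold disk in *. assert (T := Cmod_triangle z (y - z)%C).
  assert (E : forall a b : C, (b + (a - b))%C = a) by (intros; ring).
  rewrite E in T. unfold e1 in *. lra.
- intros ->. replace (RtoC 0 - z)%C with (- z)%C in Hyz by ring.
  rewrite Cmod_opp in Hyz. unfold e2 in *. lra.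
Qed.

Lemma punctured_disk_2d x y :
  punctured_disk (x, y) -> locally_2d (fun a b => punctured_disk (a, b)) x y.
Proof.
intros H. apply locally_2d_locally.
destruct (locally_punctured_disk _ H) as [e He]. exists e.
intros [a b] Hab. now apply (He (a, b)).
Qed.

Lemma continuous_C_2d (f : C -> R) x y :
  continuous f (x, y) <-> continuity_2d_pt (fun a b => f (a, b)) x y.
Proof.
rewrite continuity_2d_pt_filterlim. unfold continuous.
split; intros H; (eapply filterlim_ext; [|exact H]); now intros [a b].
Qed.

(** Continuous partial derivatives give total differentiability, which the chain rule in polar
    coordinates requires. *)
Lemma C1_on_differentiable f x y :
  C1_on punctured_disk f -> punctured_disk (x, y) ->
  differentiable_pt_lim (fun a b => f (a, b)) x y (partial_x f (x, y)) (partial_y f (x, y)).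
Proof.
intros Hf Hxy. apply filterdiff_differentiable_pt_lim.
apply (is_derive_filterdiff (fun a b => f (a, b)) x y
  (fun a b => partial_x f (a, b)) (partial_y f (x, y))).
- apply (filter_imp (fun z => punctured_disk z)); [|now apply locally_punctured_disk].
  intros [a b] Hab. apply Derive_correct. apply (Hf _ Hab).
- apply Derive_correct. apply (Hf _ Hxy).
- apply (continuous_ext (partial_x f)); [now intros [a b]|]. apply (Hf _ Hxy).
Qed.

Lemma C1_on_continuous f z :
  C1_on punctured_disk f -> punctured_disk z -> continuous f z.
Proof.
destruct z as [x y]. intros Hf Hz. apply continuous_C_2d.
apply differentiable_continuity_pt. do 2 eexists. now apply C1_on_differentiable.
Qed.

Definition polar (s t : R) : C := (exp (- s) * cos t, exp (- s) * sin t).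

Lemma Cmod_polar s t : Cmod (polar s t) = exp (- s).
Proof.
unfold Cmod, polar; simpl.
replace (exp (- s) * cos t * (exp (- s) * cos t * 1) + exp (- s) * sin t * (exp (- s) * sin t * 1))
  with (Rsqr (exp (- s)) * (Rsqr (sin t) + Rsqr (cos t))) by (unfold Rsqr; ring).
rewrite sin2_cos2, Rmult_1_r, sqrt_Rsqr; [reflexivity|apply Rlt_le, exp_pos].
Qed.

Lemma polar_punctured s t : 0 < s -> punctured_disk (polar s t).
Proof.
intros Hs. split.
- unfold disk. rewrite Cmod_polar. rewrite <- exp_0. apply exp_increasing. lra.
- intros E. apply (f_equal Cmod) in E. rewrite Cmod_polar, Cmod_0 in E.
  generalize (exp_pos (- s)). lra.
Qed.

Lemma polar_surj (z : C) : z <> RtoC 0 ->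
  exists t, - PI <= t <= PI /\ z = polar (- ln (Cmod z)) t.
Proof.
intros Hz. assert (Hr : 0 < Cmod z) by now apply Cmod_gt_0.
set (r := Cmod z) in *. destruct z as [x y].
assert (Er : r ^ 2 = x ^ 2 + y ^ 2).
{ unfold r, Cmod; simpl fst; simpl snd. rewrite pow2_sqrt; nra. }
assert (Hc : -1 <= x / r <= 1).
{ split; apply Rmult_le_reg_r with r; try lra; unfold Rdiv;
    rewrite Rmult_assoc, Rinv_l by lra; nra. }
assert (Hs : sin (acos (x / r)) = Rabs y / r).
{ rewrite sin_acos by exact Hc. unfold Rsqr.
  replace (1 - x / r * (x / r)) with ((Rabs y / r) ^ 2).
  - rewrite <- Rsqr_pow2. apply sqrt_Rsqr. apply Rdiv_le_0_compat; [apply Rabs_pos|lra].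
  - unfold Rdiv. rewrite Rpow_mult_distr, pow2_abs.
    replace (y ^ 2) with (r ^ 2 - x ^ 2) by lra. field. lra. }
assert (B := acos_bound (x / r)).
unfold polar. rewrite Ropp_involutive, exp_ln by exact Hr.
destruct (Rle_or_lt 0 y) as [Hy|Hy].
- exists (acos (x / r)). split; [lra|].
  rewrite cos_acos, Hs, (Rabs_pos_eq y) by assumption. f_equal; field; lra.
- exists (- acos (x / r)). split; [lra|].
  rewrite cos_neg, sin_neg, cos_acos, Hs, (Rabs_left y) by assumption.
  f_equal; field; lra.
Qed.

Lemma is_derive_polar_s f s t :
  C1_on punctured_disk f -> 0 < s ->
  is_derive (fun a => f (polar a t)) s
    (- (fst (polar s t) * partial_x f (polar s t) + snd (polar s t) * partial_y f (polar s t))).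
Proof.
intros Hf Hs. apply is_derive_Reals.
replace (- _) with (partial_x f (polar s t) * (- (exp (- s) * cos t))
  + partial_y f (polar s t) * (- (exp (- s) * sin t))) by (unfold polar; simpl; ring).
apply (derivable_pt_lim_comp_2d (fun a b => f (a, b))
  (fun a => exp (- a) * cos t) (fun a => exp (- a) * sin t)).
- apply C1_on_differentiable; [exact Hf|]. now apply (polar_punctured s t).
- apply is_derive_Reals. auto_derive; [auto|ring].
- apply is_derive_Reals. auto_derive; [auto|ring].
Qed.

Lemma is_derive_polar_t f s t :
  C1_on punctured_disk f -> 0 < s ->
  is_derive (fun b => f (polar s b)) t
    (- snd (polar s t) * partial_x f (polar s t) + fst (polar s t) * partial_y f (polar s t)).
Proof.
intros Hf Hs. apply is_derive_Reals.
replace (_ + _) with (partial_x f (polar s t) * (- (exp (- s) * sin t))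
  + partial_y f (polar s t) * (exp (- s) * cos t)) by (unfold polar; simpl; ring).
apply (derivable_pt_lim_comp_2d (fun a b => f (a, b))
  (fun b => exp (- s) * cos b) (fun b => exp (- s) * sin b)).
- apply C1_on_differentiable; [exact Hf|]. now apply (polar_punctured s t).
- apply is_derive_Reals. auto_derive; [auto|ring].
- apply is_derive_Reals. auto_derive; [auto|ring].
Qed.

Lemma continuity_2d_polar_fst s t : continuity_2d_pt (fun a b => fst (polar a b)) s t.
Proof.
apply continuity_2d_pt_mult.
- apply (continuity_1d_2d_pt_comp (fun a => exp (- a)) (fun a _ => a));
    [|apply continuity_2d_pt_id1].
  apply derivable_continuous_pt. exists (- exp (- s)).
  apply is_derive_Reals. auto_derive; [auto|ring].
- apply (continuity_1d_2d_pt_comp cos (fun _ b => b));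
    [apply continuity_cos|apply continuity_2d_pt_id2].
Qed.

Lemma continuity_2d_polar_snd s t : continuity_2d_pt (fun a b => snd (polar a b)) s t.
Proof.
apply continuity_2d_pt_mult.
- apply (continuity_1d_2d_pt_comp (fun a => exp (- a)) (fun a _ => a));
    [|apply continuity_2d_pt_id1].
  apply derivable_continuous_pt. exists (- exp (- s)).
  apply is_derive_Reals. auto_derive; [auto|ring].
- apply (continuity_1d_2d_pt_comp sin (fun _ b => b));
    [apply continuity_sin|apply continuity_2d_pt_id2].
Qed.

Lemma continuity_2d_polar f s t :
  continuous f (polar s t) -> continuity_2d_pt (fun a b => f (polar a b)) s t.
Proof.
intros Hf. apply continuous_C_2d in Hf. intros eps.
destruct (Hf eps) as [d Hd].
destruct (continuity_2d_polar_fst s t d) as [d1 H1].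
destruct (continuity_2d_polar_snd s t d) as [d2 H2].
assert (Hm : 0 < Rmin d1 d2) by (apply Rmin_pos; apply cond_pos).
exists (mkposreal _ Hm). intros a b Ha Hb. simpl in Ha, Hb.
generalize (Rmin_l d1 d2) (Rmin_r d1 d2); intros.
apply Hd; [apply H1|apply H2]; lra.
Qed.

(** All formulas follow from X_s = -X, Y_s = -Y, X_t = -Y, Y_t = X. In the sum of the last two,
    first-order and mixed terms cancel, leaving (X^2 + Y^2) times the Laplacian of [u]. *)
Lemma C2_on_cyl_C2 u :
  C2_on punctured_disk u ->
  let X := fun s t => fst (polar s t) in
  let Y := fun s t => snd (polar s t) in
  let P := fun f s t => f (polar s t) in
  let ux := P (partial_x u) in
  let uy := P (partial_y u) in
  let uxx := P (partial_x (partial_x u)) in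
  let uyx := P (partial_y (partial_x u)) in
  let uxy := P (partial_x (partial_y u)) in
  let uyy := P (partial_y (partial_y u)) in
  cyl_C2 0 (fun s t => P u s t - s)
    (fun s t => - (X s t * ux s t + Y s t * uy s t) - 1)
    (fun s t => - Y s t * ux s t + X s t * uy s t)
    (fun s t => X s t * ux s t + Y s t * uy s t
       + X s t * (X s t * uxx s t + Y s t * uyx s t)
       + Y s t * (X s t * uxy s t + Y s t * uyy s t))
    (fun s t => - (X s t * ux s t + Y s t * uy s t)
       - Y s t * (- Y s t * uxx s t + X s t * uyx s t)
       + X s t * (- Y s t * uxy s t + X s t * uyy s t)).
Proof.
intros [Hu [Hux Huy]] X Y P ux uy uxx uyx uxy uyy.
assert (Hper : forall s t, polar s (t + 2 * PI) = polar s t).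
{ intros s t. unfold polar. now rewrite cos_plus, sin_plus, cos_2PI, sin_2PI,
    !Rmult_0_r, !Rmult_1_r, Rminus_0_r, Rplus_0_r. }
assert (CX : forall s t, continuity_2d_pt X s t) by exact continuity_2d_polar_fst.
assert (CY : forall s t, continuity_2d_pt Y s t) by exact continuity_2d_polar_snd.
assert (Cux : forall s t, 0 < s -> continuity_2d_pt ux s t).
{ intros s t Hs. apply continuity_2d_polar, C1_on_continuous; auto using polar_punctured. }
assert (Cuy : forall s t, 0 < s -> continuity_2d_pt uy s t).
{ intros s t Hs. apply continuity_2d_polar, C1_on_continuous; auto using polar_punctured. }
assert (Cuxx : forall s t, 0 < s -> continuity_2d_pt uxx s t).
{ intros s t Hs. apply continuity_2d_polar.
  destruct (Hux _ (polar_punctured s t Hs)) as [_ [_ [Cx Cy]]]. exact Cx. }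
assert (Cuyx : forall s t, 0 < s -> continuity_2d_pt uyx s t).
{ intros s t Hs. apply continuity_2d_polar.
  destruct (Hux _ (polar_punctured s t Hs)) as [_ [_ [Cx Cy]]]. exact Cy. }
assert (Cuxy : forall s t, 0 < s -> continuity_2d_pt uxy s t).
{ intros s t Hs. apply continuity_2d_polar.
  destruct (Huy _ (polar_punctured s t Hs)) as [_ [_ [Cx Cy]]]. exact Cx. }
assert (Cuyy : forall s t, 0 < s -> continuity_2d_pt uyy s t).
{ intros s t Hs. apply continuity_2d_polar.
  destruct (Huy _ (polar_punctured s t Hs)) as [_ [_ [Cx Cy]]]. exact Cy. }
assert (DXs : forall s t, is_derive (fun a => X a t) s (- X s t)).
{ intros. unfold X, polar; simpl. auto_derive; [auto|ring]. }
assert (DYs : forall s t, is_derive (fun a => Y a t) s (- Y s t)).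
{ intros. unfold Y, polar; simpl. auto_derive; [auto|ring]. }
assert (DXt : forall s t, is_derive (fun b => X s b) t (- Y s t)).
{ intros. unfold X, Y, polar; simpl. auto_derive; [auto|ring]. }
assert (DYt : forall s t, is_derive (fun b => Y s b) t (X s t)).
{ intros. unfold X, Y, polar; simpl. auto_derive; [auto|ring]. }
assert (Dus := fun s t => is_derive_polar_s u s t Hu).
assert (Duxs := fun s t => is_derive_polar_s _ s t Hux).
assert (Duys := fun s t => is_derive_polar_s _ s t Huy).
assert (Dut := fun s t => is_derive_polar_t u s t Hu).
assert (Duxt := fun s t => is_derive_polar_t _ s t Hux).
assert (Duyt := fun s t => is_derive_polar_t _ s t Huy).
split; intros s t Hs.
- unfold P. now rewrite Hper.
- unfold X, Y, ux, uy, P. now rewrite Hper.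
- apply (is_derive_minus (fun a => P u a t) (fun a => a)); [now apply Dus|].
  apply (is_derive_id (K := R_AbsRing)).
- specialize (Duxs s t Hs). specialize (Duys s t Hs).
  auto_derive.
  + exact (conj (ex_intro _ _ (DXs s t)) (conj (ex_intro _ _ Duxs)
      (conj (ex_intro _ _ (DYs s t)) (conj (ex_intro _ _ Duys) I)))).
  + rewrite (is_derive_unique (fun a : R => X a t) _ _ (DXs s t)),
      (is_derive_unique (fun a : R => Y a t) _ _ (DYs s t)),
      (is_derive_unique (fun a : R => ux a t) _ _ Duxs),
      (is_derive_unique (fun a : R => uy a t) _ _ Duys).
    unfold X, Y, ux, uy, uxx, uyx, uxy, uyy, P. ring.
- replace (- Y s t * ux s t + X s t * uy s t)
    with (minus (- Y s t * ux s t + X s t * uy s t) 0)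
    by (unfold minus, plus, opp; simpl; ring).
  apply (is_derive_minus (fun b => P u s b) (fun b => s)); [now apply Dut|].
  apply (is_derive_const (K := R_AbsRing) (V := R_NormedModule)).
- specialize (Duxt s t Hs). specialize (Duyt s t Hs).
  auto_derive.
  + exact (conj (ex_intro _ _ (DYt s t)) (conj (ex_intro _ _ Duxt)
      (conj (ex_intro _ _ (DXt s t)) (conj (ex_intro _ _ Duyt) I)))).
  + rewrite (is_derive_unique (fun a : R => X s a) _ _ (DXt s t)),
      (is_derive_unique (fun a : R => Y s a) _ _ (DYt s t)),
      (is_derive_unique (fun a : R => ux s a) _ _ Duxt),
      (is_derive_unique (fun a : R => uy s a) _ _ Duyt).
    unfold X, Y, ux, uy, uxx, uyx, uxy, uyy, P. ring.
- apply continuity_2d_pt_minus; [|apply continuity_2d_pt_id1].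
  apply continuity_2d_polar, C1_on_continuous; auto using polar_punctured.
- repeat first [exact (CX _ _) | exact (CY _ _) | exact (Cux _ _ Hs) | exact (Cuy _ _ Hs)
    | apply continuity_2d_pt_minus | apply continuity_2d_pt_plus | apply continuity_2d_pt_opp
    | apply continuity_2d_pt_mult | apply continuity_2d_pt_const].
- repeat first [exact (CX _ _) | exact (CY _ _) | exact (Cux _ _ Hs) | exact (Cuy _ _ Hs)
    | exact (Cuxx _ _ Hs) | exact (Cuyx _ _ Hs) | exact (Cuxy _ _ Hs) | exact (Cuyy _ _ Hs)
    | apply continuity_2d_pt_minus | apply continuity_2d_pt_plus | apply continuity_2d_pt_opp
    | apply continuity_2d_pt_mult].
- repeat first [exact (CX _ _) | exact (CY _ _) | exact (Cux _ _ Hs) | exact (Cuy _ _ Hs)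
    | exact (Cuxx _ _ Hs) | exact (Cuyx _ _ Hs) | exact (Cuxy _ _ Hs) | exact (Cuyy _ _ Hs)
    | apply continuity_2d_pt_minus | apply continuity_2d_pt_plus | apply continuity_2d_pt_opp
    | apply continuity_2d_pt_mult].
Qed.

(** * Order, singular part and Wirtinger derivatives *)


(** Infinite suprema are coerced to 0, so a positive value certifies a finite one. *)
Lemma circle_sup_lub u r : 0 < circle_sup u r ->
  is_lub_Rbar (fun y => exists z : C, Cmod z = r /\ y = u z) (Finite (circle_sup u r)).
Proof.
unfold circle_sup.
assert (H := Lub_Rbar_correct (fun y => exists z : C, Cmod z = r /\ y = u z)).
destruct (Lub_Rbar _); simpl; intros; [exact H|lra|lra].
Qed.

Lemma has_order_1_circle_sup u eps : has_order u 1 -> 0 < eps ->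
  exists s0, 0 < s0 /\ forall s, s0 <= s -> Rabs (circle_sup u (exp (- s)) - s) < eps * s.
Proof.
intros Hu Heps.
destruct (Hu (ball 1 (mkposreal eps Heps)) (locally_ball 1 (mkposreal eps Heps)))
  as [d Hd].
exists (Rmax 1 (1 - ln d)).
assert (M1 := Rmax_l 1 (1 - ln d)). assert (M2 := Rmax_r 1 (1 - ln d)).
split; [lra|]. intros s Hs.
assert (P := exp_pos (- s)).
assert (B : Rabs (circle_sup u (exp (- s)) / ln (1 / exp (- s)) - 1) < eps).
{ apply (Hd (exp (- s))); [|exact P].
  change (Rabs (exp (- s) - 0) < d). rewrite Rminus_0_r, Rabs_pos_eq by lra.
  rewrite <- (exp_ln d) by apply cond_pos. apply exp_increasing. lra. }
replace (ln (1 / exp (- s))) with s in B.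
- replace (circle_sup u (exp (- s)) - s)
    with ((circle_sup u (exp (- s)) / s - 1) * s) by (field; lra).
  rewrite Rabs_mult, (Rabs_pos_eq s) by lra. apply Rmult_lt_compat_r; lra.
- unfold Rdiv. rewrite Rmult_1_l, <- exp_Ropp, Ropp_involutive. now rewrite ln_exp.
Qed.

Lemma has_order_1_upper u : has_order u 1 ->
  forall eps, 0 < eps -> exists s2, forall s t, s2 <= s -> u (polar s t) - s <= eps * s.
Proof.
intros Hu eps Heps.
(* The cap 1/2 keeps [circle_sup] positive, ruling out the default value 0. *)
assert (He : 0 < Rmin eps (/ 2)) by (apply Rmin_pos; lra).
assert (M1 := Rmin_l eps (/ 2)). assert (M2 := Rmin_r eps (/ 2)).
destruct (has_order_1_circle_sup u _ Hu He) as [s0 [Hs0 H]].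
exists s0. intros s t Hs. specialize (H s Hs). apply Rabs_def2 in H.
destruct (circle_sup_lub u (exp (- s))) as [Hub _]; [nra|].
specialize (Hub (u (polar s t))). simpl in Hub.
assert (u (polar s t) <= circle_sup u (exp (- s))).
{ apply Hub. exists (polar s t). split; [apply Cmod_polar|reflexivity]. }
nra.
Qed.

Lemma has_order_1_lower u : has_order u 1 ->
  forall eps, 0 < eps -> exists s2, forall s, s2 <= s ->
    exists t, - PI <= t <= PI /\ - (eps * s) <= u (polar s t) - s.
Proof.
intros Hu eps Heps.
(* Halving leaves the supremum strictly above s - eps s, so some point of the circle exceeds that
   level even if the supremum is not attained; the cap again excludes the default value. *)
assert (He : 0 < Rmin eps 1 / 2) by (assert (0 < Rmin eps 1) by (apply Rmin_pos; lra); lra).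
assert (M1 := Rmin_l eps 1). assert (M2 := Rmin_r eps 1).
destruct (has_order_1_circle_sup u _ Hu He) as [s0 [Hs0 H]].
exists s0. intros s Hs. specialize (H s Hs). apply Rabs_def2 in H.
destruct (circle_sup_lub u (exp (- s))) as [_ Hlub]; [nra|].
apply Classical_Prop.NNPP. intros N.
specialize (Hlub (Finite (s - eps * s))). simpl in Hlub.
assert (circle_sup u (exp (- s)) <= s - eps * s); [|nra].
apply Hlub. intros y [z [Hz ->]]. simpl.
destruct (Rle_or_lt (u z) (s - eps * s)) as [L|L]; [exact L|exfalso].
apply N. destruct (polar_surj z) as [t [Ht Ez]].
- intros E. rewrite E, Cmod_0 in Hz. generalize (exp_pos (- s)). lra.
- exists t. split; [exact Ht|]. rewrite Hz, ln_exp, Ropp_involutive in Ez.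
  rewrite <- Ez. lra.
Qed.

Lemma locally_slice_x x y : punctured_disk (x, y) ->
  locally x (fun t => punctured_disk (t, y)).
Proof.
intros H. destruct (punctured_disk_2d x y H) as [d Hd]. exists d. intros t Ht.
apply Hd; [exact Ht|]. rewrite Rminus_eq_0, Rabs_R0. apply cond_pos.
Qed.

Lemma locally_slice_y x y : punctured_disk (x, y) ->
  locally y (fun t => punctured_disk (x, t)).
Proof.
intros H. destruct (punctured_disk_2d x y H) as [d Hd]. exists d. intros t Ht.
apply Hd; [|exact Ht]. rewrite Rminus_eq_0, Rabs_R0. apply cond_pos.
Qed.

Lemma partial_x_plus (f a b : C -> R) x y d :
  (forall z, punctured_disk z -> f z = a z + b z) -> punctured_disk (x, y) ->
  ex_derive (fun t => a (t, y)) x -> is_derive (fun t => b (t, y)) x d ->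
  partial_x f (x, y) = partial_x a (x, y) + d.
Proof.
intros Hf Hxy Ha Hb. unfold partial_x; simpl Im; simpl Re.
rewrite <- (is_derive_unique _ _ _ Hb), <- Derive_plus;
  [|exact Ha|eexists; exact Hb].
apply Derive_ext_loc. apply (filter_imp _ _ (fun t => Hf (t, y))).
now apply locally_slice_x.
Qed.

Lemma partial_y_plus (f a b : C -> R) x y d :
  (forall z, punctured_disk z -> f z = a z + b z) -> punctured_disk (x, y) ->
  ex_derive (fun t => a (x, t)) y -> is_derive (fun t => b (x, t)) y d ->
  partial_y f (x, y) = partial_y a (x, y) + d.
Proof.
intros Hf Hxy Ha Hb. unfold partial_y; simpl Im; simpl Re.
rewrite <- (is_derive_unique _ _ _ Hb), <- Derive_plus;
  [|exact Ha|eexists; exact Hb].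
apply Derive_ext_loc. apply (filter_imp _ _ (fun t => Hf (x, t))).
now apply locally_slice_y.
Qed.

(** Expressing the logarithms through |z|^2 keeps square roots out of the differentiations. *)
Lemma punctured_disk_norm_sq x y : punctured_disk (x, y) ->
  0 < x ^ 2 + y ^ 2 /\ ln (x ^ 2 + y ^ 2) < 0 /\
  ln (Cmod (x, y)) = ln (x ^ 2 + y ^ 2) / 2 /\
  ln (1 / Cmod (x, y)) = - ln (x ^ 2 + y ^ 2) / 2.
Proof.
intros [Hd Hz]. assert (Hr : 0 < Cmod (x, y)) by now apply Cmod_gt_0.
unfold disk in Hd. set (r := Cmod (x, y)) in *.
assert (Er : x ^ 2 + y ^ 2 = r ^ 2).
{ unfold r, Cmod; simpl fst; simpl snd. rewrite pow2_sqrt; nra. }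
assert (El : ln (x ^ 2 + y ^ 2) = 2 * ln r).
{ rewrite Er. simpl. rewrite Rmult_1_r, ln_mult by assumption. ring. }
assert (ln r < 0) by (rewrite <- ln_1; apply ln_increasing; lra).
rewrite El. repeat split; try lra.
- rewrite Er. nra.
- unfold Rdiv. rewrite Rmult_1_l, ln_Rinv by assumption. field.
Qed.

(* [radial (|z|^2)] is [(d/dx) (log |z| + log log (1/|z|)) / x]. *)
Definition radial (q : R) : R := (1 + 2 / ln q) / q.
Definition radial' (q : R) : R := - (1 + 2 / ln q) / q ^ 2 - 2 / (q ^ 2 * ln q ^ 2).

Definition singular_part (z : C) : R := ln (Cmod z) + ln (ln (1 / Cmod z)).
Definition singular_part_x (z : C) : R := fst z * radial (fst z ^ 2 + snd z ^ 2).
Definition singular_part_y (z : C) : R := snd z * radial (fst z ^ 2 + snd z ^ 2).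

Lemma is_derive_singular_part_x x y : punctured_disk (x, y) ->
  is_derive (fun t => singular_part (t, y)) x (singular_part_x (x, y)).
Proof.
intros H. destruct (punctured_disk_norm_sq x y H) as [Hq [Hl _]].
apply is_derive_ext_loc with
  (fun t => ln (t ^ 2 + y ^ 2) / 2 + ln (- ln (t ^ 2 + y ^ 2) / 2)).
- generalize (locally_slice_x x y H). apply filter_imp. intros t Ht.
  destruct (punctured_disk_norm_sq t y Ht) as [_ [_ [E1 E2]]].
  symmetry. exact (f_equal2 Rplus E1 (f_equal ln E2)).
- unfold singular_part_x, radial; simpl fst; simpl snd.
  auto_derive; simpl in *; [repeat split; lra|]. field; lra.
Qed.

Lemma is_derive_singular_part_y x y : punctured_disk (x, y) ->
  is_derive (fun t => singular_part (x, t)) y (singular_part_y (x, y)).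
Proof.
intros H. destruct (punctured_disk_norm_sq x y H) as [Hq [Hl _]].
apply is_derive_ext_loc with
  (fun t => ln (x ^ 2 + t ^ 2) / 2 + ln (- ln (x ^ 2 + t ^ 2) / 2)).
- generalize (locally_slice_y x y H). apply filter_imp. intros t Ht.
  destruct (punctured_disk_norm_sq x t Ht) as [_ [_ [E1 E2]]].
  symmetry. exact (f_equal2 Rplus E1 (f_equal ln E2)).
- unfold singular_part_y, radial; simpl fst; simpl snd.
  auto_derive; simpl in *; [repeat split; lra|]. field; lra.
Qed.

Lemma is_derive_radial q : 0 < q -> ln q <> 0 -> is_derive radial q (radial' q).
Proof.
intros Hq Hl. unfold radial, radial'. auto_derive; [repeat split; lra|].
field; lra.
Qed.

Lemma is_derive_singular_part_xx x y : punctured_disk (x, y) ->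
  is_derive (fun t => singular_part_x (t, y)) x
    (radial (x ^ 2 + y ^ 2) + 2 * x ^ 2 * radial' (x ^ 2 + y ^ 2)).
Proof.
intros H. destruct (punctured_disk_norm_sq x y H) as [Hq [Hl _]].
assert (D := is_derive_radial _ Hq ltac:(lra)).
unfold singular_part_x; simpl fst; simpl snd.
auto_derive; [simpl in *; eexists; exact D|].
replace (x * (x * 1)) with (x ^ 2) by ring. replace (y * (y * 1)) with (y ^ 2) by ring.
rewrite (is_derive_unique (fun q : R => radial q) _ _ D). ring.
Qed.

Lemma is_derive_singular_part_yy x y : punctured_disk (x, y) ->
  is_derive (fun t => singular_part_y (x, t)) y
    (radial (x ^ 2 + y ^ 2) + 2 * y ^ 2 * radial' (x ^ 2 + y ^ 2)).
Proof.
intros H. destruct (punctured_disk_norm_sq x y H) as [Hq [Hl _]].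
assert (D := is_derive_radial _ Hq ltac:(lra)).
unfold singular_part_y; simpl fst; simpl snd.
auto_derive; [simpl in *; eexists; exact D|].
replace (x * (x * 1)) with (x ^ 2) by ring. replace (y * (y * 1)) with (y ^ 2) by ring.
rewrite (is_derive_unique (fun q : R => radial q) _ _ D). ring.
Qed.

Lemma is_derive_singular_part_yx x y : punctured_disk (x, y) ->
  is_derive (fun t => singular_part_x (x, t)) y (2 * x * y * radial' (x ^ 2 + y ^ 2)).
Proof.
intros H. destruct (punctured_disk_norm_sq x y H) as [Hq [Hl _]].
assert (D := is_derive_radial _ Hq ltac:(lra)).
unfold singular_part_x; simpl fst; simpl snd.
auto_derive; [simpl in *; eexists; exact D|].
replace (x * (x * 1)) with (x ^ 2) by ring. replace (y * (y * 1)) with (y ^ 2) by ring.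
rewrite (is_derive_unique (fun q : R => radial q) _ _ D). ring.
Qed.

Lemma is_derive_singular_part_xy x y : punctured_disk (x, y) ->
  is_derive (fun t => singular_part_y (t, y)) x (2 * x * y * radial' (x ^ 2 + y ^ 2)).
Proof.
intros H. destruct (punctured_disk_norm_sq x y H) as [Hq [Hl _]].
assert (D := is_derive_radial _ Hq ltac:(lra)).
unfold singular_part_y; simpl fst; simpl snd.
auto_derive; [simpl in *; eexists; exact D|].
replace (x * (x * 1)) with (x ^ 2) by ring. replace (y * (y * 1)) with (y ^ 2) by ring.
rewrite (is_derive_unique (fun q : R => radial q) _ _ D). ring.
Qed.

Lemma C2_on_partials_commute u z : C2_on punctured_disk u -> punctured_disk z ->
  partial_x (partial_y u) z = partial_y (partial_x u) z.
Proof.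
intros [Hu [Hux Huy]] Hz. destruct z as [x y].
unfold partial_x, partial_y; simpl.
apply (Schwarz (fun a b => u (a, b))).
- generalize (punctured_disk_2d x y Hz). apply locally_2d_impl, locally_2d_forall.
  intros a b Hab.
  destruct (Hu _ Hab) as [A1 [A2 _]]. destruct (Hux _ Hab) as [_ [B2 _]].
  destruct (Huy _ Hab) as [B1 _].
  split; [exact A1|split; [exact A2|split; [exact B1|exact B2]]].
- destruct (Huy _ Hz) as [_ [_ [Cx _]]]. apply continuous_C_2d in Cx. exact Cx.
- destruct (Hux _ Hz) as [_ [_ [_ Cy]]]. apply continuous_C_2d in Cy. exact Cy.
Qed.

(** Holds for every [w], since [Derive] is total and commutes with constant factors. The price is
    the difference of mixed partials in the imaginary part. *)
Lemma wirtinger_z_zbar_real w z :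
  wirtinger_z_zbar w z =
  (/ 4 * laplacian w z, / 4 * (partial_x (partial_y w) z - partial_y (partial_x w) z)).
Proof.
assert (Hpx : forall c f, partial_x (fun s => c * f s) z = c * partial_x f z)
  by (intros; apply Derive_scal).
assert (Hpy : forall c f, partial_y (fun s => c * f s) z = c * partial_y f z)
  by (intros; apply Derive_scal).
assert (E : forall s, wirtinger_zbar (fun z => RtoC (w z)) s
  = (/ 2 * partial_x w s, / 2 * partial_y w s)).
{ intros s. unfold wirtinger_zbar, Cpartial_x, Cpartial_y. simpl.
  assert (Zx : partial_x (fun _ => 0) s = 0) by exact (Derive_const 0 (Re s)).
  assert (Zy : partial_y (fun _ => 0) s = 0) by exact (Derive_const 0 (Im s)).
  rewrite Zx, Zy. change (partial_x (fun s => w s) s) with (partial_x w s).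
  change (partial_y (fun s => w s) s) with (partial_y w s).
  unfold Cinv, Cmult, Cplus, Ci, RtoC; simpl. f_equal; field. }
unfold wirtinger_z_zbar, wirtinger_z, Cpartial_x, Cpartial_y.
assert (X1 : partial_x (fun s => Re (wirtinger_zbar (fun z => RtoC (w z)) s)) z
  = / 2 * partial_x (partial_x w) z).
{ rewrite <- Hpx. apply Derive_ext. intros t. now rewrite E. }
assert (X2 : partial_x (fun s => Im (wirtinger_zbar (fun z => RtoC (w z)) s)) z
  = / 2 * partial_x (partial_y w) z).
{ rewrite <- Hpx. apply Derive_ext. intros t. now rewrite E. }
assert (Y1 : partial_y (fun s => Re (wirtinger_zbar (fun z => RtoC (w z)) s)) z
  = / 2 * partial_y (partial_x w) z).
{ rewrite <- Hpy. apply Derive_ext. intros t. now rewrite E. }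
assert (Y2 : partial_y (fun s => Im (wirtinger_zbar (fun z => RtoC (w z)) s)) z
  = / 2 * partial_y (partial_y w) z).
{ rewrite <- Hpy. apply Derive_ext. intros t. now rewrite E. }
rewrite X1, X2, Y1, Y2. unfold laplacian.
unfold Cinv, Cmult, Cplus, Cminus, Copp, Ci, RtoC; simpl. f_equal; field.
Qed.

(** ln |z| is harmonic, so only ln ln (1/|z|) contributes, with Laplacian -1/(|z|^2 ln^2 (1/|z|)).
    The imaginary part vanishes because mixed partials agree, for [u] by Schwarz and for the
    singular part by explicit formula. *)
Lemma wirtinger_z_zbar_remainder u w z :
  C2_on punctured_disk u ->
  (forall z, punctured_disk z -> w z = u z + singular_part z) ->
  punctured_disk z ->
  wirtinger_z_zbar w z =
    RtoC (/ 4 * (laplacian u z - / (Cmod z ^ 2 * ln (1 / Cmod z) ^ 2))).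
Proof.
intros Hu2 Hw Hz. rewrite wirtinger_z_zbar_real.
assert (Hsym := C2_on_partials_commute u z Hu2 Hz).
destruct Hu2 as [Hu [Hux Huy]].
assert (Wx : forall z, punctured_disk z -> partial_x w z = partial_x u z + singular_part_x z).
{ intros [x y] H. apply (partial_x_plus w u singular_part); auto.
  - apply (Hu _ H).
  - now apply is_derive_singular_part_x. }
assert (Wy : forall z, punctured_disk z -> partial_y w z = partial_y u z + singular_part_y z).
{ intros [x y] H. apply (partial_y_plus w u singular_part); auto.
  - apply (Hu _ H).
  - now apply is_derive_singular_part_y. }
destruct z as [x y].
destruct (Hux _ Hz) as [A1 [A2 _]]. destruct (Huy _ Hz) as [B1 [B2 _]].
unfold laplacian.
rewrite (partial_x_plus _ _ _ x y _ Wx Hz A1 (is_derive_singular_part_xx x y Hz)).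
rewrite (partial_y_plus _ _ _ x y _ Wx Hz A2 (is_derive_singular_part_yx x y Hz)).
rewrite (partial_x_plus _ _ _ x y _ Wy Hz B1 (is_derive_singular_part_xy x y Hz)).
rewrite (partial_y_plus _ _ _ x y _ Wy Hz B2 (is_derive_singular_part_yy x y Hz)).
rewrite Hsym. destruct (punctured_disk_norm_sq x y Hz) as [Hq [Hl [_ El]]].
assert (Er : Cmod (x, y) ^ 2 = x ^ 2 + y ^ 2).
{ unfold Cmod; simpl fst; simpl snd. rewrite pow2_sqrt; nra. }
rewrite El, Er. unfold RtoC, radial, radial'. f_equal; [|ring].
field. lra.
Qed.

(** * Asymptotics of the remainder *)


(** The fourth power in (a s / 4)^4 <= exp (a s) leaves one spare factor 1/s, which absorbs the
    constants. *)
Lemma exp_decay_le_cube M a k : 0 < a -> 0 < k ->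
  exists S, forall s, S <= s -> M * exp (- (a * s)) <= k / s ^ 3.
Proof.
intros Ha Hk.
set (m := Rabs M * (4 / a) ^ 4).
assert (Hm : 0 <= m).
{ apply Rmult_le_pos; [apply Rabs_pos|]. apply pow_le, Rlt_le, Rdiv_lt_0_compat; lra. }
exists (Rmax 1 (m / k)). intros s Hs.
assert (M1 := Rmax_l 1 (m / k)). assert (M2 := Rmax_r 1 (m / k)).
assert (He : (a / 4 * s) ^ 4 <= exp (a * s)).
{ replace (a * s) with (a / 4 * s + a / 4 * s + (a / 4 * s + a / 4 * s)) by field.
  rewrite !exp_plus. set (x := a / 4 * s).
  assert (0 <= x) by (unfold x; nra).
  assert (x <= exp x) by (generalize (exp_ineq1_le x); lra).
  replace (x ^ 4) with (x * x * (x * x)) by ring.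
  assert (0 <= x * x <= exp x * exp x) by nra. nra. }
assert (Hp : 0 < (a / 4 * s) ^ 4) by (apply pow_lt; apply Rmult_lt_0_compat; lra).
rewrite exp_Ropp.
apply Rle_trans with (Rabs M * / (a / 4 * s) ^ 4).
- apply Rle_trans with (Rabs M * / exp (a * s)).
  + apply Rmult_le_compat_r; [|apply Rle_abs].
    apply Rlt_le, Rinv_0_lt_compat, exp_pos.
  + apply Rmult_le_compat_l; [apply Rabs_pos|]. now apply Rinv_le_contravar.
- replace (Rabs M * / (a / 4 * s) ^ 4) with (m / s / s ^ 3)
    by (unfold m; field; lra).
  apply Rmult_le_compat_r; [apply Rlt_le, Rinv_0_lt_compat, pow_lt; lra|].
  apply Rmult_le_reg_r with s; [lra|]. unfold Rdiv.
  rewrite Rmult_assoc, Rinv_l, Rmult_1_r by lra.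
  apply Rmult_le_reg_r with (/ k); [now apply Rinv_0_lt_compat|].
  replace (k * s * / k) with s by (field; lra). unfold Rdiv in M2. lra.
Qed.

Lemma holder_polar kappa k : locally_holder_on disk kappa -> 0 < k ->
  exists S, forall s t, S <= s ->
    Rabs (kappa (RtoC 0) - kappa (polar s t)) <= k / s ^ 3.
Proof.
intros HK Hk.
destruct (HK (RtoC 0)) as [a [M [Ha [delta H]]]].
{ unfold disk. rewrite Cmod_0. lra. }
destruct (exp_decay_le_cube M a k) as [S HS]; [lra|exact Hk|].
exists (Rmax S (Rmax 1 (1 - ln delta))). intros s t Hs.
assert (M1 := Rmax_l S (Rmax 1 (1 - ln delta))).
assert (M2 := Rmax_r S (Rmax 1 (1 - ln delta))).
assert (M3 := Rmax_l 1 (1 - ln delta)). assert (M4 := Rmax_r 1 (1 - ln delta)).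
assert (P := exp_pos (- s)).
destruct (polar_punctured s t ltac:(lra)) as [Hd Hne].
eapply Rle_trans; [|apply HS; lra].
replace (exp (- (a * s))) with (Rpower (Cmod (RtoC 0 - polar s t)%C) a).
- apply H.
  + unfold disk. rewrite Cmod_0. lra.
  + exact Hd.
  + replace (RtoC 0 - RtoC 0)%C with (RtoC 0) by ring. rewrite Cmod_0. apply cond_pos.
  + replace (polar s t - RtoC 0)%C with (polar s t) by ring.
    rewrite Cmod_polar, <- (exp_ln delta) by apply cond_pos. apply exp_increasing. lra.
  + now apply not_eq_sym.
- replace (RtoC 0 - polar s t)%C with (- polar s t)%C by ring.
  rewrite Cmod_opp, Cmod_polar. unfold Rpower. rewrite ln_exp. f_equal. ring.
Qed.

Lemma exp_sub_1_bound x : Rabs x <= 1 -> Rabs (exp x - 1) <= 3 * Rabs x.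
Proof.
intros Hx. apply Rabs_le_between in Hx.
assert (L := exp_ineq1_le x). assert (L' := exp_ineq1_le (- x)).
assert (E : exp (- x) * exp x = 1) by (rewrite <- exp_plus, Rplus_opp_l; apply exp_0).
assert (P := exp_pos x).
assert (Hle : exp x <= 3).
{ apply Rle_trans with (exp 1); [|apply exp_le_3].
  destruct (Req_dec x 1) as [->|N]; [lra|]. apply Rlt_le, exp_increasing. lra. }
assert (U : exp x - 1 <= x * exp x) by nra.
unfold Rabs at 2. destruct (Rcase_abs x); apply Rabs_le; nra.
Qed.

Theorem corollary3p3
  (kappa u w : C -> R)
  (kappa_holder : locally_holder_on disk kappa)
  (kappa_neg : kappa (RtoC 0) < 0)
  (u_C2 : C2_on punctured_disk u)
  (u_eq : forall z : C, punctured_disk z ->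
     laplacian u z = - kappa z * exp (2 * u z))
  (u_order : has_order u 1)
  (w_def : forall z : C, punctured_disk z ->
     u z = - ln (Cmod z) - ln (ln (1 / Cmod z)) + w z) :
  bigO_at_0 (wirtinger_z_zbar w)
    (fun z => / (Cmod z) ^ 2 * / (ln (1 / Cmod z)) ^ 3).
Proof.
set (k := - kappa (RtoC 0)). assert (Hk : 0 < k) by (unfold k; lra).
destruct (holder_polar kappa k kappa_holder Hk) as [S0 HS0].
set (S := Rmax S0 5).
assert (HS : forall s t, S <= s -> Rabs (- kappa (polar s t) - k) <= k / s ^ 3).
{ intros s t Hs. replace (- kappa (polar s t) - k)
    with (kappa (RtoC 0) - kappa (polar s t)) by (unfold k; ring).
  apply HS0. eapply Rle_trans; [apply Rmax_l|exact Hs]. }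
destruct (cyl_asymptotics _ _ _ _ _ (fun s t => - kappa (polar s t)) k S
  (C2_on_cyl_C2 u u_C2) Hk (Rmax_r _ _)) as [c [s1 [Hc Has]]].
{ intros s t Hs.
  (* The cylinder Laplacian is |z|^2 times the planar one, and |z|^2 = exp (- 2 s) turns exp (2 u)
     into exp (2 v) for v = u - s. *)
  assert (E := u_eq _ (polar_punctured s t Hs)). unfold laplacian in E.
  assert (Er : fst (polar s t) ^ 2 + snd (polar s t) ^ 2 = exp (- s) ^ 2).
  { unfold polar; simpl. generalize (sin2_cos2 t). unfold Rsqr. intros T.
    transitivity (exp (- s) * exp (- s) * (sin t * sin t + cos t * cos t)); [ring|].
    rewrite T. ring. }
  replace (2 * (u (polar s t) - s)) with (- s + - s + 2 * u (polar s t)) by ring.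
  rewrite !exp_plus.
  transitivity ((fst (polar s t) ^ 2 + snd (polar s t) ^ 2)
    * (partial_x (partial_x u) (polar s t) + partial_y (partial_y u) (polar s t))); [ring|].
  rewrite Er, E. ring. }
{ exact HS. }
{ now apply has_order_1_upper. }
{ now apply has_order_1_lower. }
(* The bound [2 * c] gives |2 eta| <= 1 below, as the linear estimate of the exponential
   requires. *)
set (s2 := Rmax (Rmax S s1) (2 * c)).
assert (Hs2 : S <= s2 /\ s1 <= s2 /\ 2 * c <= s2 /\ 5 <= S).
{ unfold s2. generalize (Rmax_l (Rmax S s1) (2 * c)) (Rmax_r (Rmax S s1) (2 * c))
    (Rmax_l S s1) (Rmax_r S s1) (Rmax_r S0 5 : 5 <= S). lra. }
(* 1/4 relates w_(z zbar) to the Laplacian; 3 comes from |e| exp (2 eta) <= 3/s, and 6 c from |exp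
   (2 eta) - 1| <= 3 |2 eta|. *)
exists (/ 4 * (3 + 6 * c)).
assert (Hd : 0 < exp (- s2) / 2) by (generalize (exp_pos (- s2)); lra).
exists (mkposreal _ Hd). intros z Hz Hz0.
assert (Hr : 0 < Cmod z) by now apply Cmod_gt_0.
assert (Hrs : Cmod z < exp (- s2)).
{ destruct z as [x y]. destruct Hz as [Hx Hy].
  change (Rabs (x - 0) < exp (- s2) / 2) in Hx. change (Rabs (y - 0) < exp (- s2) / 2) in Hy.
  rewrite Rminus_0_r in Hx, Hy.
  assert (T := Cmod_triangle (RtoC x) (Ci * RtoC y)%C).
  replace (RtoC x + Ci * RtoC y)%C with (x, y) in T
    by (unfold Cplus, Cmult, RtoC, Ci; simpl; f_equal; ring).
  rewrite Cmod_mult, !Cmod_R in T. replace (Cmod Ci) with 1 in T; [lra|].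
  unfold Cmod; simpl. replace (0 * (0 * 1) + 1 * (1 * 1)) with 1 by ring.
  now rewrite sqrt_1. }
set (s := - ln (Cmod z)).
assert (Hs : s2 < s).
{ assert (L := ln_increasing _ _ Hr Hrs). rewrite ln_exp in L. unfold s. lra. }
assert (Hrexp : Cmod z = exp (- s)) by (unfold s; rewrite Ropp_involutive, exp_ln; auto).
assert (Hln : ln (1 / Cmod z) = s).
{ unfold Rdiv. rewrite Rmult_1_l, ln_Rinv by exact Hr. reflexivity. }
destruct (polar_surj z Hz0) as [t [Ht Ezt]]. fold s in Ezt.
assert (Hpz : punctured_disk z) by (rewrite Ezt; apply polar_punctured; lra).
rewrite (wirtinger_z_zbar_remainder u w z u_C2); [|
  intros y Hy; rewrite (w_def y Hy); unfold singular_part; ring|exact Hpz].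
rewrite Cmod_R, Hln, (u_eq z Hpz).
(* On the cylinder this is v + ln s + (ln k)/2, the quantity estimated by [cyl_asymptotics]. *)
set (eta := w z + ln k / 2).
assert (Heta : Rabs eta <= c / s).
{ specialize (Has s t ltac:(lra) Ht). rewrite <- Ezt in Has.
  replace eta with (u z - s + ln s + ln k / 2); [exact Has|].
  unfold eta. rewrite (w_def z Hpz), Hln. unfold s. ring. }
set (e := (- kappa z - k) / k).
assert (He : Rabs e <= / s).
{ assert (T := HS s t ltac:(lra)). rewrite <- Ezt in T. unfold e.
  unfold Rdiv. rewrite Rabs_mult, (Rabs_pos_eq (/ k))
    by (apply Rlt_le, Rinv_0_lt_compat; exact Hk).
  apply Rle_trans with (k / s ^ 3 * / k).
  - apply Rmult_le_compat_r; [apply Rlt_le, Rinv_0_lt_compat; exact Hk|exact T].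
  - replace (k / s ^ 3 * / k) with (/ s ^ 3) by (field; lra).
    apply Rinv_le_contravar; [lra|]. assert (1 <= s ^ 2) by nra. nra. }
assert (Hcs : c / s <= / 2).
{ apply Rmult_le_reg_r with s; [lra|]. field_simplify; lra. }
assert (H2eta : Rabs (2 * eta) = 2 * Rabs eta)
  by (rewrite Rabs_mult, (Rabs_pos_eq 2); lra).
assert (Hexp := exp_sub_1_bound (2 * eta) ltac:(lra)). rewrite H2eta in Hexp.
assert (Hfac : Rabs ((1 + e) * exp (2 * eta) - 1) <= (3 + 6 * c) / s).
{ replace ((1 + e) * exp (2 * eta) - 1) with (e * exp (2 * eta) + (exp (2 * eta) - 1)) by ring.
  eapply Rle_trans; [apply Rabs_triang|]. rewrite Rabs_mult, (Rabs_pos_eq (exp _))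
    by apply Rlt_le, exp_pos.
  assert (exp (2 * eta) <= 3).
  { apply Rle_trans with (exp 1); [|apply exp_le_3].
    assert (2 * eta <= 1) by (generalize (Rle_abs (2 * eta)); lra).
    destruct (Req_dec (2 * eta) 1) as [->|N]; [lra|]. apply Rlt_le, exp_increasing. lra. }
  assert (Rabs e * exp (2 * eta) <= / s * 3).
  { apply Rmult_le_compat; [apply Rabs_pos|apply Rlt_le, exp_pos|exact He|assumption]. }
  unfold Rdiv in *. lra. }
(* With [e] the relative error of - kappa against k, the Laplacian of [u] is the model term 1/(|z|^2
   s^2) times (1 + e) exp (2 eta), a factor within O(1/s) of 1. Subtracting the model term therefore
   gains the third power of the logarithm. *)
assert (Hlap : - kappa z * exp (2 * u z)
  = (1 + e) * exp (2 * eta) / (exp (- s) ^ 2 * s ^ 2)).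
{ assert (Ek : - kappa z = k * (1 + e)) by (unfold e; field; lra).
  assert (Eu : 2 * u z = - ln s + - ln s + (- ln k + (2 * eta + (s + s)))).
  { unfold eta. rewrite (w_def z Hpz), Hln. unfold s. field. }
  rewrite Ek, Eu, !exp_plus, !exp_m_ln, (exp_Ropp s) by lra.
  generalize (exp_pos s); intros. field. lra. }
assert (P : 0 < exp (- s)) by apply exp_pos.
rewrite Hlap, Hrexp.
replace (/ 4 * ((1 + e) * exp (2 * eta) / (exp (- s) ^ 2 * s ^ 2) - / (exp (- s) ^ 2 * s ^ 2)))
  with (((1 + e) * exp (2 * eta) - 1) * (/ 4 * / (exp (- s) ^ 2 * s ^ 2)))
  by (field; lra).
assert (Q : 0 < / 4 * / (exp (- s) ^ 2 * s ^ 2)).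
{ apply Rmult_lt_0_compat; [lra|]. apply Rinv_0_lt_compat.
  apply Rmult_lt_0_compat; apply pow_lt; lra. }
rewrite Rabs_mult, (Rabs_pos_eq _ (Rlt_le _ _ Q)).
assert (Q' : 0 < / exp (- s) ^ 2 * / s ^ 3)
  by (apply Rmult_lt_0_compat; apply Rinv_0_lt_compat; apply pow_lt; lra).
rewrite (Rabs_pos_eq _ (Rlt_le _ _ Q')).
apply Rle_trans with ((3 + 6 * c) / s * (/ 4 * / (exp (- s) ^ 2 * s ^ 2))).
- apply Rmult_le_compat_r; [now apply Rlt_le|exact Hfac].
- apply Req_le. field. lra.
Qed.
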